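(* Let $(A,\mu,E,\Delta,\epsilon)$ be a regular weak multiplier bialgebra over a field $k$, and write $A^*=\mathrm{Lin}(A,k)$. The following are equivalent: (1) $\langle(\mathrm{id}\otimes\omega)T_1(a\otimes b)\mid a,b\in A,\ \omega\in A^*\rangle=A$; (2) $\langle(\mathrm{id}\otimes\omega)T_3(a\otimes b)\mid a,b\in A,\ \omega\in A^*\rangle=A$; (3) $\langle(\mathrm{id}\otimes\epsilon)T_1(a\otimes b)\mid a,b\in A\rangle=A$; (4) $\langle(\mathrm{id}\otimes\epsilon)T_3(a\otimes b)\mid a,b\in A\rangle=A$; (5) $\{\sqcap^R(a)\mid a\in A\}=\{\overline\sqcap^R(a)\mid a\in A\}$. Also the following are equivalent to each other: (1') $\langle(\omega\otimes\mathrm{id})T_2(a\otimes b)\mid a,b\in A,\ \omega\in A^*\rangle=A$; (2') $\langle(\omega\otimes\mathrm{id})T_4(a\otimes b)\mid a,b\in A,\ \omega\in A^*\rangle=A$; (3') $\langle(\epsilon\otimes\mathrm{id})T_2(a\otimes b)\mid a,b\in A\rangle=A$; (4') $\langle(\epsilon\otimes\mathrm{id})T_4(a\otimes b)\mid a,b\in A\rangle=A$; (5') $\{\sqcap^L(a)\mid a\in A\}=\{\overline\sqcap^L(a)\mid a\in A\}$.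
   Context: Let $k$ be a field; $\langle X\rangle$ denotes linear span. A non-unital $k$-algebra $A$ is idempotent if its multiplication $\mu$ is surjective and has non-degenerate multiplication if ($ab=0\ \forall a$)$\Rightarrow b=0$ and ($ba=0\ \forall a$)$\Rightarrow b=0$. $\mathbb M(A)$ is its multiplier algebra (pairs $(\lambda,\rho)$ of linear maps $A\to A$ with $a\lambda(b)=\rho(a)b$), a unital algebra containing $A$ as a dense ideal; $A\otimes A\subseteq\mathbb M(A\otimes A)$. Multiplicative $\gamma:A\to\mathbb M(B)$ with idempotent $e\in\mathbb M(B)$, $\langle\gamma(a)b\rangle=eB$, $\langle b\gamma(a)\rangle=Be$ extends uniquely to multiplicative $\overline\gamma:\mathbb M(A)\to\mathbb M(B)$ with $\overline\gamma(1)=e$. A weak multiplier bialgebra: idempotent $A$ with non-degenerate multiplication, idempotent $E\in\mathbb M(A\otimes A)$, multiplicative linear $\Delta:A\to\mathbb M(A\otimes A)$, linear $\epsilon:A\to k$ with: (i) $T_1(a\otimes b):=\Delta(a)(1\otimes b)$, $T_2(a\otimes b):=(a\otimes1)\Delta(b)$ lie in $A\otimes A$; (ii) $(T_2\otimes\mathrm{id})(\mathrm{id}\otimes T_1)=(\mathrm{id}\otimes T_1)(T_2\otimes\mathrm{id})$; (iii) $(\epsilon\otimes\mathrm{id})T_1=\mu=(\mathrm{id}\otimes\epsilon)T_2$; (iv) $\langle\Delta(a)(b\otimes b')\rangle=\langle E(b\otimes b')\rangle$, $\langle(b\otimes b')\Delta(a)\rangle=\langle(b\otimes b')E\rangle$;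 (v) $(E\otimes1)(1\otimes E)=E^{(3)}=(1\otimes E)(E\otimes1)$ with $E^{(3)}:=(\overline{\mathrm{id}\otimes\Delta})(E)=(\overline{\Delta\otimes\mathrm{id}})(E)$; (vi) $(\epsilon\otimes\mathrm{id})((1\otimes a)E(b\otimes c))=(\epsilon\otimes\mathrm{id})(\Delta(a)(b\otimes c))$ and $(\epsilon\otimes\mathrm{id})((a\otimes b)E(1\otimes c))=(\epsilon\otimes\mathrm{id})((a\otimes b)\Delta(c))$. Regular: also $T_3(a\otimes b):=(1\otimes b)\Delta(a)$ and $T_4(a\otimes b):=\Delta(b)(a\otimes1)$ lie in $A\otimes A$. Multipliers for $a\in A$: $\overline\sqcap^L(a)$ with $\overline\sqcap^L(a)b=(\epsilon\otimes\mathrm{id})((a\otimes1)\Delta(b))$, $b\overline\sqcap^L(a)=(\epsilon\otimes\mathrm{id})((a\otimes b)E)$; $\overline\sqcap^R(a)$ with $b\overline\sqcap^R(a)=(\mathrm{id}\otimes\epsilon)(\Delta(b)(1\otimes a))$, $\overline\sqcap^R(a)b=(\mathrm{id}\otimes\epsilon)(E(b\otimes a))$; $\sqcap^L(a)$ with $\sqcap^L(a)b=(\epsilon\otimes\mathrm{id})(E(a\otimes b))$, $b\sqcap^L(a)=(\epsilon\otimes\mathrm{id})(\Delta(b)(a\otimes1))$; $\sqcap^R(a)$ with $b\sqcap^R(a)=(\mathrm{id}\otimes\epsilon)((b\otimes a)E)$, $\sqcap^R(a)b=(\mathrm{id}\otimes\epsilon)((1\otimes a)\Delta(b))$. *)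

(* Defs.v *)
From HB Require Import structures.
From mathcomp Require Import all_boot all_order all_algebra.
From Stdlib Require Import ClassicalEpsilon.
Set Implicit Arguments. Unset Strict Implicit. Unset Printing Implicit Defensive.
Import GRing.Theory.
Local Open Scope ring_scope.

Section LinearAlgebra.
Variable k : fieldType.

Definition islinear (U W : lmodType k) (f : U -> W) : Prop :=
  forall (c : k) (x y : U), f (c *: x + y) = c *: f x + f y.
Definition isfunctional (U : lmodType k) (f : U -> k) : Prop :=
  forall (c : k) (x y : U), f (c *: x + y) = c * f x + f y.
Definition isbilinear (U V W : lmodType k) (f : U -> V -> W) : Prop :=
  (forall y, islinear (fun x => f x y)) /\ (forall x, islinear (f x)).
Definition istrilinear (U V X W : lmodType k) (f : U -> V -> X -> W) : Prop :=
  [/\ forall y z, islinear (fun x => f x y z),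
      forall x z, islinear (fun y => f x y z) &
      forall x y, islinear (f x y)].

Definition span (V : lmodType k) (P : V -> Prop) : V -> Prop :=
  fun v => exists (n : nat) (c : 'I_n -> k) (x : 'I_n -> V),
    (forall i, P (x i)) /\ v = \sum_(i < n) c i *: x i.
Definition spans_all (V : lmodType k) (P : V -> Prop) : Prop :=
  forall v : V, span P v.
Definition same_span (V : lmodType k) (P Q : V -> Prop) : Prop :=
  forall v : V, span P v <-> span Q v.

(* The tensor products A (x) A and A (x) A (x) A, given by their universal
   properties (they are unique up to unique isomorphism). *)
Record tensor2 (A : lmodType k) := Tensor2 {
  tt2 : lmodType k;
  tens2 : A -> A -> tt2;
  tens2_bilin : isbilinear tens2;
  tens2_univ : forall (W : lmodType k) (f : A -> A -> W), isbilinear f ->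
    exists! g : tt2 -> W, islinear g /\ forall a b, g (tens2 a b) = f a b }.

Record tensor3 (A : lmodType k) := Tensor3 {
  tt3 : lmodType k;
  tens3 : A -> A -> A -> tt3;
  tens3_trilin : istrilinear tens3;
  tens3_univ : forall (W : lmodType k) (f : A -> A -> A -> W), istrilinear f ->
    exists! g : tt3 -> W, islinear g /\ forall a b c, g (tens3 a b c) = f a b c }.

(* the linear map A(x)A -> W induced by a bilinear f (unique when f is bilinear) *)
Definition lift2 (A : lmodType k) (T : tensor2 A) (W : lmodType k)
    (f : A -> A -> W) : tt2 T -> W :=
  epsilon (inhabits (fun _ => 0))
    (fun g : tt2 T -> W => islinear g /\ forall a b, g (tens2 T a b) = f a b).
Definition lift3 (A : lmodType k) (T : tensor3 A) (W : lmodType k)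
    (f : A -> A -> A -> W) : tt3 T -> W :=
  epsilon (inhabits (fun _ => 0))
    (fun g : tt3 T -> W => islinear g /\ forall a b c, g (tens3 T a b c) = f a b c).

(* Multipliers of a non-unital algebra (B, mulB): pairs (lambda, rho);
   m b := m.1 b and b m := m.2 b. *)
Definition mult (B : Type) : Type := ((B -> B) * (B -> B))%type.
Definition is_mult (B : lmodType k) (mulB : B -> B -> B) (m : mult B) : Prop :=
  [/\ islinear m.1, islinear m.2 & forall x y, mulB x (m.1 y) = mulB (m.2 x) y].
Definition mmul (B : Type) (m n : mult B) : mult B :=
  (fun x => m.1 (n.1 x), fun x => n.2 (m.2 x)).
Definition mone (B : Type) : mult B := (id, id).
Definition madd (B : lmodType k) (m n : mult B) : mult B :=
  (fun x => m.1 x + n.1 x, fun x => m.2 x + n.2 x).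
Definition mscale (B : lmodType k) (c : k) (m : mult B) : mult B :=
  (fun x => c *: m.1 x, fun x => c *: m.2 x).
Definition iota (B : Type) (mulB : B -> B -> B) (x : B) : mult B :=
  (mulB x, fun y => mulB y x).
Definition in_alg (B : Type) (mulB : B -> B -> B) (m : mult B) : Prop :=
  exists x, iota mulB x = m.
(* the element of B that m is (when in_alg m) *)
Definition elt (B : lmodType k) (mulB : B -> B -> B) (m : mult B) : B :=
  epsilon (inhabits 0) (fun x => iota mulB x = m).

End LinearAlgebra.

Arguments lift2 {k A} T {W} f _.
Arguments lift3 {k A} T {W} f _.
Arguments tens2 {k A} _ _ _.
Arguments tens3 {k A} _ _ _ _.
Arguments tt2 {k A} _.
Arguments tt3 {k A} _.


Section WMBA.
Variables (k : fieldType) (A : lmodType k) (T2 : tensor2 A) (T3 : tensor3 A).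
Variables (mu : A -> A -> A) (E : mult (tt2 T2)) (Delta : A -> mult (tt2 T2))
          (eps : A -> k).

Local Notation t2 := (tens2 T2).
Local Notation t3 := (tens3 T3).

Definition mul2 (s t : tt2 T2) : tt2 T2 :=
  lift2 T2 (fun a b => lift2 T2 (fun c d => t2 (mu a c) (mu b d)) t) s.
Definition mul3 (s t : tt3 T3) : tt3 T3 :=
  lift3 T3 (fun a b c =>
    lift3 T3 (fun x y z => t3 (mu a x) (mu b y) (mu c z)) t) s.
Definition mu2 : tt2 T2 -> A := lift2 T2 mu.

Definition one_t (b : A) : mult (tt2 T2) :=
  (lift2 T2 (fun x y => t2 x (mu b y)), lift2 T2 (fun x y => t2 x (mu y b))).
Definition t_one (a : A) : mult (tt2 T2) :=
  (lift2 T2 (fun x y => t2 (mu a x) y), lift2 T2 (fun x y => t2 (mu x a) y)).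

Definition T1e (a b : A) : tt2 T2 := elt mul2 (mmul (Delta a) (one_t b)).
Definition T2e (a b : A) : tt2 T2 := elt mul2 (mmul (t_one a) (Delta b)).
Definition T3e (a b : A) : tt2 T2 := elt mul2 (mmul (one_t b) (Delta a)).
Definition T4e (a b : A) : tt2 T2 := elt mul2 (mmul (Delta b) (t_one a)).

Definition eps_id : tt2 T2 -> A := lift2 T2 (fun x y => eps x *: y).
Definition id_eps : tt2 T2 -> A := lift2 T2 (fun x y => eps y *: x).
Definition om_id (om : A -> k) : tt2 T2 -> A := lift2 T2 (fun x y => om x *: y).
Definition id_om (om : A -> k) : tt2 T2 -> A := lift2 T2 (fun x y => om y *: x).

Definition ext12 (t : tt2 T2) (c : A) : tt3 T3 := lift2 T2 (fun x y => t3 x y c) t.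
Definition ext23 (a : A) (t : tt2 T2) : tt3 T3 := lift2 T2 (fun x y => t3 a x y) t.

Definition T2_id : tt3 T3 -> tt3 T3 := lift3 T3 (fun a b c => ext12 (T2e a b) c).
Definition id_T1 : tt3 T3 -> tt3 T3 := lift3 T3 (fun a b c => ext23 a (T1e b c)).

Definition E_one : mult (tt3 T3) :=
  (lift3 T3 (fun x y z => ext12 (E.1 (t2 x y)) z),
   lift3 T3 (fun x y z => ext12 (E.2 (t2 x y)) z)).
Definition one_E : mult (tt3 T3) :=
  (lift3 T3 (fun x y z => ext23 x (E.1 (t2 y z))),
   lift3 T3 (fun x y z => ext23 x (E.2 (t2 y z)))).

Definition id_Delta (a b : A) : mult (tt3 T3) :=
  (lift3 T3 (fun x y z => ext23 (mu a x) ((Delta b).1 (t2 y z))),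
   lift3 T3 (fun x y z => ext23 (mu x a) ((Delta b).2 (t2 y z)))).
Definition Delta_id (a b : A) : mult (tt3 T3) :=
  (lift3 T3 (fun x y z => ext12 ((Delta a).1 (t2 x y)) (mu b z)),
   lift3 T3 (fun x y z => ext12 ((Delta a).2 (t2 x y)) (mu z b))).

Definition is_mult_ext (gam : A -> A -> mult (tt3 T3)) (e : mult (tt3 T3))
    (G : mult (tt2 T2) -> mult (tt3 T3)) : Prop :=
  [/\ forall m, is_mult mul2 m -> is_mult mul3 (G m),
      forall m n, is_mult mul2 m -> is_mult mul2 n -> G (mmul m n) = mmul (G m) (G n),
      forall c m n, is_mult mul2 m -> is_mult mul2 n ->
        G (madd (mscale c m) n) = madd (mscale c (G m)) (G n),
      forall a b, G (iota mul2 (t2 a b)) = gam a b &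
      G (mone _) = e].

Definition PiL (a : A) : mult A :=
  (fun b => eps_id (E.1 (t2 a b)), fun b => eps_id (T4e a b)).
Definition PibarL (a : A) : mult A :=
  (fun b => eps_id (T2e a b), fun b => eps_id (E.2 (t2 a b))).
Definition PiR (a : A) : mult A :=
  (fun b => id_eps (T3e b a), fun b => id_eps (E.2 (t2 b a))).
Definition PibarR (a : A) : mult A :=
  (fun b => id_eps (E.1 (t2 b a)), fun b => id_eps (T1e b a)).

Definition regular_wmba : Prop :=
      (isbilinear mu /\ (forall a b c, mu (mu a b) c = mu a (mu b c))) /\
      (forall a, exists t, mu2 t = a) /\
      ((forall b, (forall a, mu a b = 0) -> b = 0) /\
      (forall b, (forall a, mu b a = 0) -> b = 0)) /\
      (is_mult mul2 E /\ mmul E E = E) /\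
      [/\ forall a, is_mult mul2 (Delta a),
          forall c a b, Delta (c *: a + b) = madd (mscale c (Delta a)) (Delta b) &
          forall a b, Delta (mu a b) = mmul (Delta a) (Delta b)] /\
      isfunctional eps /\
      (forall a b, [/\ in_alg mul2 (mmul (Delta a) (one_t b)),
                       in_alg mul2 (mmul (t_one a) (Delta b)),
                       in_alg mul2 (mmul (one_t b) (Delta a)) &
                       in_alg mul2 (mmul (Delta b) (t_one a))]) /\
      (forall u, T2_id (id_T1 u) = id_T1 (T2_id u)) /\
      (forall a b, eps_id (T1e a b) = mu a b /\ id_eps (T2e a b) = mu a b) /\
      (same_span (fun t => exists a b b', t = (Delta a).1 (t2 b b'))
                (fun t => exists b b', t = E.1 (t2 b b')) /\
      same_span (fun t => exists a b b', t = (Delta a).2 (t2 b b'))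
                (fun t => exists b b', t = E.2 (t2 b b'))) /\
      [/\ mmul E_one one_E = mmul one_E E_one,
          (forall G, is_mult_ext id_Delta one_E G ->
             G E = mmul E_one one_E /\ G E = mmul one_E E_one) &
          (forall G, is_mult_ext Delta_id E_one G ->
             G E = mmul E_one one_E /\ G E = mmul one_E E_one)] /\
      ((forall a b c, eps_id ((one_t a).1 (E.1 (t2 b c)))
                     = eps_id ((Delta a).1 (t2 b c))) /\
      (forall a b c, eps_id ((one_t c).2 (E.2 (t2 a b)))
                     = eps_id ((Delta c).2 (t2 a b)))).

End WMBA.

(* Main.v *)
Require Import Defs.
From HB Require Import structures.
From mathcomp Require Import all_boot all_order all_algebra.
From mathcomp Require boolp classical_sets.
From Stdlib Require Import ClassicalEpsilon.
Set Implicit Arguments. Unset Strict Implicit. Unset Printing Implicit Defensive.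
Import GRing.Theory Defs.
Local Open Scope ring_scope.

(** Write [T1(a,b) = a1 (x) a2 b], [T3(a,b) = a1 (x) b a2], and so on.

    Extending the multiplicative maps [Delta (x) id] and [id (x) Delta] to
    multipliers and evaluating them on [E], axiom (v) yields, after applying the
    counit to the middle leg,
    [PibarR(a1) (x) a2 b = E (1 (x) ab)] and [PiR(a1) (x) b a2 = (1 (x) ba) E],
    together with their mirror images.  Hence [(id (x) om)(E (1 (x) bc))] lies in
    [PibarR(A)] and [(id (x) om)((1 (x) bc) E)] lies in [PiR(A)].

    (1) <-> (2): over a field, [(id (x) om) t] lies in the span of the elements
    [(id (x) om')((1 (x) c) t)], because a functional [phi] vanishing on these
    satisfies [c (phi (x) id)(t) = 0] for all [c], so [(phi (x) id)(t) = 0] by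
    non-degeneracy; and [(1 (x) c) T1(a,b) = T3(a,c) (1 (x) b)].
    (1) -> (3): [c a1 om(a2 b)] is a sum of terms [p . (id (x) om(q -))(E (1 (x) b))],
    where [c a1 (x) a2 = sum p (x) q].
    (1) -> (5): [PiR(a1 om(a2 b)) = (id (x) om)((1 (x) a) E (1 (x) b))] is in [PibarR(A)].
    (5) -> (3): [A = A . PiR(A)] always holds, since [a b1 (x) b2] is fixed by
    right multiplication by [E].
    Everything else follows by passing to the opposite algebra and to the
    opposite coalgebra. *)

(** * Subspaces and separating functionals *)

Section Subspaces.
Variable k : fieldType.

Definition subspace (V : lmodType k) (S : V -> Prop) : Prop :=
  S 0 /\ forall c x y, S x -> S y -> S (c *: x + y).

Lemma span_subspace (V : lmodType k) (P : V -> Prop) : subspace (span P).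
Proof.
split=> [|c x y [n [a [u [Pu ->]]]] [m [b [w [Pw ->]]]]].
  by exists 0%N, (fun=> 0), (fun=> 0); split; [case | rewrite big_ord0].
exists (n + m)%N, (fun i => match split i with inl j => c * a j | inr j => b j end),
  (fun i => match split i with inl j => u j | inr j => w j end).
split=> [i|]; first by case: (split i).
rewrite big_split_ord scaler_sumr; congr (_ + _); apply: eq_bigr => i _.
  by rewrite (unsplitK (inl i)) scalerA.
by rewrite (unsplitK (inr i)).
Qed.

Lemma span_mem (V : lmodType k) (P : V -> Prop) x : P x -> span P x.
Proof.
by move=> Px; exists 1%N, (fun=> 1), (fun=> x); rewrite big_ord1 scale1r.
Qed.

Lemma span_min (V : lmodType k) (P S : V -> Prop) :
  subspace S -> (forall x, P x -> S x) -> forall v, span P v -> S v.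
Proof.
move=> [S0 S1] PS v [n [c [x [Px ->]]]]; apply: (big_ind S) => // [y z Sy Sz|i _].
  by rewrite -[y]scale1r; apply: S1.
by rewrite -[_ *: _]addr0; apply: S1 => //; apply: PS.
Qed.

Lemma span_sub (V : lmodType k) (P Q : V -> Prop) :
  (forall x, P x -> span Q x) -> forall v, span P v -> span Q v.
Proof. by move=> PQ; apply: span_min => //; apply: span_subspace. Qed.

(** Modulo a subspace maximal among those that contain [S] and avoid [v], each [x] is congruent to a
    unique multiple of [v]; the coefficient is the functional. *)
Lemma separating_functional (V : lmodType k) (S : V -> Prop) (v : V) :
  subspace S -> ~ S v ->
  exists om : V -> k, [/\ isfunctional om, forall x, S x -> om x = 0 & om v = 1].
Proof.
move=> [S0 S1] Sv.
(* Zorn's lemma runs over arbitrary sets [X], with [S] adjoined afterwards, so that the empty chain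
   is harmless: its union yields [S] itself. *)
pose U (X : V -> Prop) x := X x \/ S x.
pose P (X : V -> Prop) := subspace (U X) /\ ~ U X v.
have [F FP Ftot|M [[[_ M1] Mv] Mmax]] := @classical_sets.Zorn_bigcup V P.
  split; last first.
    by case=> [[X FX Xv]|//]; case: (FP X FX) => _; apply; left.
  split=> [|c x y [[X FX Xx]|Sx] [[Y FY Yy]|Sy]]; first by right.
  - have [XY|YX] := Ftot _ _ FX FY.
      by have [[_ /(_ c x y (or_introl (XY _ Xx)) (or_introl Yy)) [h|h]] _] :=
        FP Y FY; [left; exists Y|right].
    by have [[_ /(_ c x y (or_introl Xx) (or_introl (YX _ Yy))) [h|h]] _] :=
      FP X FX; [left; exists X|right].
  - by have [[_ /(_ c x y (or_introl Xx) (or_intror Sy)) [h|h]] _] := FP X FX;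
      [left; exists X|right].
  - by have [[_ /(_ c x y (or_intror Sx) (or_introl Yy)) [h|h]] _] := FP Y FY;
      [left; exists Y|right].
  - by right; apply: S1.
have M0 : U M 0 by right.
have MD x y : U M x -> U M y -> U M (x + y).
  by move=> Mx My; rewrite -[x]scale1r; apply: M1.
have MZ c x : U M x -> U M (c *: x).
  by move=> Mx; rewrite -[_ *: _]addr0; apply: M1.
have ex x : exists a : k, U M (x - a *: v).
  apply: NNPP => nex.
  (* [N] is the sum of the maximal subspace and the line of [x]. It avoids [v]: a relation [v - b x]
     in the subspace has [b] nonzero and could be solved for [x], against [nex]. This contradicts
     maximality. *)
  pose N y := exists2 b : k, U M (y - b *: x) & True.
  have MN y : U M y -> N y by move=> My; exists 0; rewrite // scale0r subr0.
  have UN y : U N y -> N y by case=> // Sy; apply: MN; right.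
  apply: (Mmax N).
    split=> [y My|NM]; first by apply: MN; left.
    apply: nex; exists 0; rewrite scale0r subr0; left; apply: NM.
    by exists 1; rewrite // scale1r subrr.
  split; last first.
    move=> /UN[b Mb _]; have [b0|b0] := eqVneq b 0.
      by apply: Mv; rewrite b0 scale0r subr0 in Mb.
    apply: nex; exists b^-1.
    have -> : x - b^-1 *: v = - b^-1 *: (v - b *: x).
      by rewrite scalerBr scalerA !mulNr mulVf // scaleN1r opprK scaleNr addrC.
    exact: MZ.
  split=> [|c y z /UN[b Mb _] /UN[d Md _]]; first by right.
  left; exists (c * b + d) => //.
  have -> : c *: y + z - (c * b + d) *: x = c *: (y - b *: x) + (z - d *: x).
    by rewrite scalerBr scalerA scalerDl opprD addrACA.
  exact: M1.
have uniq x a b : U M (x - a *: v) -> U M (x - b *: v) -> a = b.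
  move=> Ha Hb; have [//|ab] := eqVneq a b; case: Mv.
  have -> : v = (a - b)^-1 *: ((-1) *: (x - a *: v) + (x - b *: v)).
    by rewrite scaleN1r opprB addrA subrK -scalerBl scalerA mulVf ?subr_eq0 // scale1r.
  by apply: MZ; apply: M1.
exists (fun x => epsilon (inhabits 0) (fun a => U M (x - a *: v))).
have omP x := epsilon_spec (inhabits 0) _ (ex x).
split=> [c x y|x Sx|]; last 2 first.
- by apply: uniq (omP x) _; rewrite scale0r subr0; right.
- by apply: uniq (omP v) _; rewrite scale1r subrr.
apply: uniq (omP _) _; set a := epsilon _ _; set b := epsilon _ _.
have -> : c *: x + y - (c * a + b) *: v = c *: (x - a *: v) + (y - b *: v).
  by rewrite scalerBr scalerA scalerDl opprD addrACA.
by apply: M1; apply: omP.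
Qed.

End Subspaces.

(** * Linear maps on tensor products *)

Section Linearity.
Variable k : fieldType.
Implicit Types U V W X Y : lmodType k.

Lemma islinear_id U : islinear (fun x : U => x).
Proof. by []. Qed.

Lemma islinear_zero U W : islinear (fun _ : U => 0 : W).
Proof. by move=> c x y; rewrite scaler0 addr0. Qed.

Lemma islinear_comp U V W (g : V -> W) (f : U -> V) :
  islinear g -> islinear f -> islinear (fun x => g (f x)).
Proof. by move=> Hg Hf c x y; rewrite Hf Hg. Qed.

Lemma islinear_scale U V c (f : U -> V) :
  islinear f -> islinear (fun x => c *: f x).
Proof.
by move=> Hf a x y; rewrite Hf scalerDr !scalerA (mulrC c a).
Qed.

Lemma islinear_scalel U V (om : U -> k) (v : V) :
  isfunctional om -> islinear (fun x => om x *: v).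
Proof. by move=> Hom c x y; rewrite Hom scalerDl scalerA. Qed.

Lemma islinear_add U V (f g : U -> V) :
  islinear f -> islinear g -> islinear (fun x => f x + g x).
Proof.
by move=> Hf Hg c x y; rewrite Hf Hg scalerDr addrACA.
Qed.

Lemma islinear_bil_l U V W X (b : U -> V -> W) (f : X -> U) y :
  isbilinear b -> islinear f -> islinear (fun x => b (f x) y).
Proof. by move=> [Hb _] Hf c x z; rewrite Hf Hb. Qed.

Lemma islinear_bil_r U V W X (b : U -> V -> W) x (f : X -> V) :
  isbilinear b -> islinear f -> islinear (fun y => b x (f y)).
Proof. by move=> [_ Hb] Hf c y z; rewrite Hf Hb. Qed.

Lemma islinear_tri1 U V W X Y (b : U -> V -> X -> W) (f : Y -> U) y z :
  istrilinear b -> islinear f -> islinear (fun x => b (f x) y z).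
Proof. by move=> [Hb _ _] Hf c u v; rewrite Hf Hb. Qed.

Lemma islinear_tri2 U V W X Y (b : U -> V -> X -> W) x (f : Y -> V) z :
  istrilinear b -> islinear f -> islinear (fun y => b x (f y) z).
Proof. by move=> [_ Hb _] Hf c u v; rewrite Hf Hb. Qed.

Lemma islinear_tri3 U V W X Y (b : U -> V -> X -> W) x y (f : Y -> X) :
  istrilinear b -> islinear f -> islinear (fun z => b x y (f z)).
Proof. by move=> [_ _ Hb] Hf c u v; rewrite Hf Hb. Qed.

Lemma islinear_bigsum U V n (f : 'I_n -> U -> V) :
  (forall i, islinear (f i)) -> islinear (fun x => \sum_(i < n) f i x).
Proof.
move=> Hf c x y; rewrite scaler_sumr -big_split; apply: eq_bigr => i _.
exact: Hf.
Qed.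

Lemma isfunctional_comp U V (om : V -> k) (f : U -> V) :
  isfunctional om -> islinear f -> isfunctional (fun x => om (f x)).
Proof. by move=> Hom Hf c x y; rewrite Hf Hom. Qed.

Lemma islinear0 U V (f : U -> V) : islinear f -> f 0 = 0.
Proof. by move=> Hf; have := Hf (-1) 0 0; rewrite !scaleN1r oppr0 addr0 addNr. Qed.

Lemma islinearD U V (f : U -> V) x y : islinear f -> f (x + y) = f x + f y.
Proof. by move=> Hf; have := Hf 1 x y; rewrite !scale1r. Qed.

Lemma islinearZ U V (f : U -> V) c x : islinear f -> f (c *: x) = c *: f x.
Proof. by move=> Hf; have := Hf c x 0; rewrite (islinear0 Hf) !addr0. Qed.

Lemma islinearB U V (f : U -> V) x y : islinear f -> f (x - y) = f x - f y.
Proof. by move=> Hf; rewrite -scaleN1r addrC Hf scaleN1r addrC. Qed.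

Lemma islinear_sum U V (f : U -> V) n (x : 'I_n -> U) :
  islinear f -> f (\sum_(i < n) x i) = \sum_(i < n) f (x i).
Proof.
move=> Hf; apply: (big_morph f); last exact: islinear0.
by move=> x' y; apply: islinearD.
Qed.

Lemma islinear_subspace U V (f g : U -> V) :
  islinear f -> islinear g -> subspace (fun x => f x = g x).
Proof.
by move=> Hf Hg; split=> [|c x y]; rewrite ?(islinear0 Hf) ?(islinear0 Hg) // Hf Hg
  => -> ->.
Qed.

Lemma subspace_preim U V (f : U -> V) (S : V -> Prop) :
  islinear f -> subspace S -> subspace (fun x => S (f x)).
Proof.
by move=> Hf [S0 S1]; split=> [|c x y Sx Sy]; rewrite ?(islinear0 Hf) // Hf; apply: S1.
Qed.

Lemma separated U (x : U) : (forall om : U -> k, isfunctional om -> om x = 0) -> x = 0.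
Proof.
move=> Hx; apply: NNPP => x0.
have [|om [lin_om _ omx]] := @separating_functional k U (fun y => y = 0) x _ x0.
  by split=> // c y z -> ->; rewrite scaler0 addr0.
by have := oner_neq0 k; rewrite -omx Hx // eqxx.
Qed.

Section Tensor2.
Variables (A : lmodType k) (T : tensor2 A).
Local Notation t2 := (tens2 T).

Lemma lift2_spec W (f : A -> A -> W) : isbilinear f ->
  islinear (lift2 T f) /\ forall a b, lift2 T f (t2 a b) = f a b.
Proof.
move=> /(tens2_univ T)[g [Hg _]].
by apply: (epsilon_spec (inhabits (fun=> 0)) (fun g : tt2 T -> W =>
  islinear g /\ forall a b, g (t2 a b) = f a b)); exists g.
Qed.

Lemma islinear_lift2 W (f : A -> A -> W) : isbilinear f -> islinear (lift2 T f).
Proof. by case/lift2_spec. Qed.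

Lemma lift2E W (f : A -> A -> W) a b :
  isbilinear f -> lift2 T f (t2 a b) = f a b.
Proof. by case/lift2_spec. Qed.

Lemma tens2_ext W (f g : tt2 T -> W) : islinear f -> islinear g ->
  (forall a b, f (t2 a b) = g (t2 a b)) -> forall t, f t = g t.
Proof.
move=> Hf Hg fg t.
have [|h [_ hu]] := tens2_univ T (f := fun a b => f (t2 a b)).
  by have [b1 b2] := tens2_bilin T; split=> ?;
    [exact: (islinear_comp Hf (b1 _)) | exact: (islinear_comp Hf (b2 _))].
by rewrite -(hu f (conj Hf (fun _ _ => erefl)))
  -(hu g (conj Hg (fun a b => esym (fg a b)))).
Qed.

(** A functional vanishing on all pure tensors but not at [t] would be a second linear map, besides
    zero, inducing the zero bilinear map. *)
Lemma tens2_span t : Defs.span (fun t => exists a b, t = t2 a b) t.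
Proof.
apply: NNPP => nt.
have [om [lin_om om0 omt]] := separating_functional (span_subspace _) nt.
have := @tens2_ext k^o om (fun=> 0) lin_om (@islinear_zero _ _) _ t.
have /eqP := oner_neq0 k; rewrite -omt => H /(_ _) E; apply: H; apply: E => a b.
by apply: om0; apply: span_mem; exists a, b.
Qed.

Lemma tens2_ind (S : tt2 T -> Prop) :
  subspace S -> (forall a b, S (t2 a b)) -> forall t, S t.
Proof.
move=> HS Sab t; apply: span_min HS _ _ (tens2_span t) => _ [a [b ->]]; exact: Sab.
Qed.

Lemma islinear_lift2_param U W (F : U -> A -> A -> W) t :
  (forall x, isbilinear (F x)) -> (forall a b, islinear (fun x => F x a b)) ->
  islinear (fun x => lift2 T (F x) t).
Proof.
move=> HF1 HF2 c x y; move: t; apply: tens2_ext => [||a b].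
- exact: islinear_lift2.
- by apply: islinear_add; [apply: islinear_scale|]; apply: islinear_lift2.
- by rewrite !lift2E // HF2.
Qed.

End Tensor2.

Section Tensor3.
Variables (A : lmodType k) (T : tensor3 A).
Local Notation t3 := (tens3 T).

Lemma lift3_spec W (f : A -> A -> A -> W) : istrilinear f ->
  islinear (lift3 T f) /\ forall a b c, lift3 T f (t3 a b c) = f a b c.
Proof.
move=> /(tens3_univ T)[g [Hg _]].
by apply: (epsilon_spec (inhabits (fun=> 0)) (fun g : tt3 T -> W =>
  islinear g /\ forall a b c, g (t3 a b c) = f a b c)); exists g.
Qed.

Lemma islinear_lift3 W (f : A -> A -> A -> W) : istrilinear f -> islinear (lift3 T f).
Proof. by case/lift3_spec. Qed.

Lemma lift3E W (f : A -> A -> A -> W) a b c :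
  istrilinear f -> lift3 T f (t3 a b c) = f a b c.
Proof. by case/lift3_spec. Qed.

Lemma tens3_ext W (f g : tt3 T -> W) : islinear f -> islinear g ->
  (forall a b c, f (t3 a b c) = g (t3 a b c)) -> forall t, f t = g t.
Proof.
move=> Hf Hg fg t.
have [|h [_ hu]] := tens3_univ T (f := fun a b c => f (t3 a b c)).
  by have [b1 b2 b3] := tens3_trilin T; split=> ? ?; [exact: (islinear_comp Hf (b1 _ _))
    | exact: (islinear_comp Hf (b2 _ _)) | exact: (islinear_comp Hf (b3 _ _))].
by rewrite -(hu f (conj Hf (fun _ _ _ => erefl)))
  -(hu g (conj Hg (fun a b c => esym (fg a b c)))).
Qed.

Lemma tens3_span t : Defs.span (fun t => exists a b c, t = t3 a b c) t.
Proof.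
apply: NNPP => nt.
have [om [lin_om om0 omt]] := separating_functional (span_subspace _) nt.
have := @tens3_ext k^o om (fun=> 0) lin_om (@islinear_zero _ _) _ t.
have /eqP := oner_neq0 k; rewrite -omt => H /(_ _) E; apply: H; apply: E => a b c.
by apply: om0; apply: span_mem; exists a, b, c.
Qed.

Lemma tens3_ind (S : tt3 T -> Prop) :
  subspace S -> (forall a b c, S (t3 a b c)) -> forall t, S t.
Proof.
move=> HS Sab t; apply: span_min HS _ _ (tens3_span t) => _ [a [b [c ->]]]; exact: Sab.
Qed.

Lemma islinear_lift3_param U W (F : U -> A -> A -> A -> W) t :
  (forall x, istrilinear (F x)) -> (forall a b c, islinear (fun x => F x a b c)) ->
  islinear (fun x => lift3 T (F x) t).
Proof.
move=> HF1 HF2 c x y; move: t; apply: tens3_ext => [||a b d].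
- exact: islinear_lift3.
- by apply: islinear_add; [apply: islinear_scale|]; apply: islinear_lift3.
- by rewrite !lift3E // HF2.
Qed.

End Tensor3.
End Linearity.

Create HintDb lin.
#[global] Hint Resolve tens2_bilin tens3_trilin : lin.

(* Proves [islinear], [isbilinear], [istrilinear] and [isfunctional] goals by
   recursion on the syntax of the map, using the hypotheses on its atoms. *)
Ltac lin_atom := solve [assumption | auto with lin nocore].
Ltac lin :=
  cbv beta;
  lazymatch goal with
  | |- forall _, _ => intro; lin
  | |- isbilinear _ => first [lin_atom | split; intro; lin]
  | |- istrilinear _ => first [lin_atom | split; intros; lin]
  | |- isfunctional _ =>
      first [ lin_atom
            | match goal with |- isfunctional (fun x => ?om (@?f x)) =>
                refine (@isfunctional_comp _ _ _ om f _ _); [lin_atom | lin] end ]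
  | |- islinear (fun x => x) => exact (@islinear_id _ _)
  | |- islinear (fun x => lift2 ?T (@?F x) (@?t x)) =>
      match goal with
      | |- islinear (fun x => lift2 ?T ?F (@?t x)) =>
          refine (@islinear_comp _ _ _ _ (lift2 T F) t _ _); lin
      | |- islinear (fun x => lift2 ?T (@?F x) ?t) =>
          refine (@islinear_lift2_param _ _ T _ _ F t _ _); intros; lin
      end
  | |- islinear (lift2 ?T ?F) => refine (@islinear_lift2 _ _ T _ F _); lin
  | |- islinear (fun x => lift3 ?T (@?F x) (@?t x)) =>
      match goal with
      | |- islinear (fun x => lift3 ?T ?F (@?t x)) =>
          refine (@islinear_comp _ _ _ _ (lift3 T F) t _ _); lin
      | |- islinear (fun x => lift3 ?T (@?F x) ?t) =>
          refine (@islinear_lift3_param _ _ T _ _ F t _ _); intros; lin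
      end
  | |- islinear (lift3 ?T ?F) => refine (@islinear_lift3 _ _ T _ F _); lin
  | |- islinear (fun x => (@?c x) *: (@?f x)) =>
      match goal with
      | |- islinear (fun x => ?c *: (@?f x)) => refine (@islinear_scale _ _ _ c f _); lin
      | |- islinear (fun x => (@?f x) *: ?v) =>
          refine (@islinear_scalel _ _ _ f v _); lin
      end
  | |- islinear (fun x => (@?f x) + (@?g x)) =>
      refine (@islinear_add _ _ _ f g _ _); lin
  | |- islinear (fun x => \sum_(i < ?n) @?f i x) =>
      refine (@islinear_bigsum _ _ _ n f _); lin
  | |- islinear (fun _ => _) => first [lin_atom | lin_app]
  | |- islinear ?g =>
      first [ lin_atom
            | match goal with
              | |- islinear (?b ?y) =>
                  refine (@islinear_bil_r _ _ _ _ _ b y _ _ (@islinear_id _ _)); lin_atom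
              end ]
  end
with lin_app :=
  match goal with
  | |- islinear (fun x => ?b (@?f x) ?y) =>
      refine (@islinear_bil_l _ _ _ _ _ b f y _ _); [lin_atom | lin]
  | |- islinear (fun x => ?b ?y (@?f x)) =>
      refine (@islinear_bil_r _ _ _ _ _ b y f _ _); [lin_atom | lin]
  | |- islinear (fun x => ?b (@?f x) ?y ?z) =>
      refine (@islinear_tri1 _ _ _ _ _ _ b f y z _ _); [lin_atom | lin]
  | |- islinear (fun x => ?b ?y (@?f x) ?z) =>
      refine (@islinear_tri2 _ _ _ _ _ _ b y f z _ _); [lin_atom | lin]
  | |- islinear (fun x => ?b ?y ?z (@?f x)) =>
      refine (@islinear_tri3 _ _ _ _ _ _ b y z f _ _); [lin_atom | lin]
  | |- islinear (fun x => ?g (@?f x)) =>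
      refine (@islinear_comp _ _ _ _ g f _ _); [lin_atom | lin]
  end.

(** Reduces an equation of expressions linear in the tensor [t] to pure tensors; [text3] does so for
    three legs, and [liftE] evaluates the induced maps there. *)
Ltac text t :=
  pattern t;
  match goal with
  | |- (fun x => @?L x = @?R x) t =>
      refine (@tens2_ext _ _ _ _ L R _ _ _ t); [lin | lin | intros; cbv beta]
  end.
Ltac text3 t :=
  pattern t;
  match goal with
  | |- (fun x => @?L x = @?R x) t =>
      refine (@tens3_ext _ _ _ _ L R _ _ _ t); [lin | lin | intros; cbv beta]
  end.
Ltac liftE :=
  repeat first [rewrite lift2E; [|solve [lin]] | rewrite lift3E; [|solve [lin]]].

(** * Joint injectivity of maps acting on the legs of a tensor *)

Section Legs.
Variables (k : fieldType) (A : lmodType k).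

(** By induction: when the remainder [P y] of a new vector is nonzero, it is added to the [e j],
    with coefficient functional [phi] after [P], where [phi (P y) = 1]. Composing with [P] gives
    coefficient zero to the vectors already expanded. *)
Lemma finite_dual_system (s : seq A) :
  exists (m : nat) (om : 'I_m -> A -> k) (e : 'I_m -> A),
    (forall j, isfunctional (om j)) /\
    forall x, x \in s -> x = \sum_(j < m) om j x *: e j.
Proof.
elim: s => [|y s [m [om [e [lin_om se]]]]].
  by exists 0%N, (fun _ _ => 0), (fun=> 0); split=> [[]|].
pose P x := x - \sum_(j < m) om j x *: e j.
have lin_s : islinear (fun x => \sum_(j < m) om j x *: e j) by lin.
have lin_P : islinear P by move=> c x z; rewrite /P lin_s scalerBr opprD addrACA.
have [Py0|Py0] := eqVneq (P y) 0.
  exists m, om, e; split=> // x; rewrite inE => /orP[/eqP ->|/se //].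
  exact: subr0_eq Py0.
have [||phi [lin_phi _ phiy]] := @separating_functional k A (fun x => x = 0) (P y).
- by split=> // c x z -> ->; rewrite scaler0 addr0.
- exact/eqP.
exists m.+1, (fun j => oapp om (fun x => phi (P x)) (unlift ord0 j)),
  (fun j => oapp e (P y) (unlift ord0 j)); split=> [j|x].
  by case: unliftP => [i _|_] /=; [apply: lin_om | lin].
rewrite inE big_ord_recl unlift_none /=.
have -> : \sum_(i < m) oapp om (fun z => phi (P z)) (unlift ord0 (lift ord0 i)) x *:
    oapp e (P y) (unlift ord0 (lift ord0 i)) = \sum_(i < m) om i x *: e i.
  by apply: eq_bigr => i _; rewrite liftK.
case/orP=> [/eqP ->|xs]; first by rewrite phiy scale1r /P subrK.
have Px : P x = 0 by rewrite /P -se // subrr.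
have phi0 : phi 0 = 0 by exact: (@islinear0 k A k^o phi lin_phi).
by rewrite Px phi0 scale0r add0r; apply: se.
Qed.

(* Replacing [T] by [swap2 T] amounts to passing to the opposite coalgebra. *)
Definition swap2 (T : tensor2 A) : tensor2 A.
Proof.
refine (@Tensor2 k A (tt2 T) (fun a b => tens2 T b a) _ _).
  by have [] := tens2_bilin T; split.
move=> W f bf; have bf' : isbilinear (fun a b => f b a) by case: bf; split.
have [g [[g1 g2] gu]] := tens2_univ T bf'; exists g; split; first by split.
by move=> h [h1 h2]; apply: gu; split.
Defined.

(** Both sides are chosen by [epsilon] from predicates that differ only in the order of the
    quantified variables, so extensionality makes the choices equal. *)
Lemma lift2_swap (T : tensor2 A) (W : lmodType k) (f : A -> A -> W) :
  lift2 (swap2 T) f = lift2 T (fun a b => f b a).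
Proof.
rewrite /lift2; congr epsilon; apply: boolp.funext => g; apply: boolp.propext.
by split=> -[? H]; split=> // a b; have := H b a.
Qed.

(** Companion of [swap2] on three legs: it trades the first two legs for the last two, hence
    [E (x) 1] for [1 (x) E]. *)
Definition swap3 (T : tensor3 A) : tensor3 A.
Proof.
refine (@Tensor3 k A (tt3 T) (fun a b c => tens3 T c b a) _ _).
  by have [] := tens3_trilin T; split.
move=> W f bf; have bf' : istrilinear (fun a b c => f c b a) by case: bf; split.
have [g [[g1 g2] gu]] := tens3_univ T bf'; exists g; split; first by split.
by move=> h [h1 h2]; apply: gu; split.
Defined.

Lemma lift3_swap (T : tensor3 A) (W : lmodType k) (f : A -> A -> A -> W) :
  lift3 (swap3 T) f = lift3 T (fun a b c => f c b a).
Proof.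
rewrite /lift3; congr epsilon; apply: boolp.funext => g; apply: boolp.propext.
by split=> -[? H]; split=> // a b c; have := H c b a.
Qed.

Variables (T2 : tensor2 A) (T3 : tensor3 A).
Local Notation t2 := (tens2 T2).
Local Notation t3 := (tens3 T3).

(** The finitely many first legs of [t] are expanded in a finite dual system, which gives
    [t = sum_j e_j (x) (om_j (x) id)(t)]. *)
Lemma slice2_eq0 t : (forall om, isfunctional om -> om_id (T2 := T2) om t = 0) -> t = 0.
Proof.
move=> H; have [n [c [x [Px def_t]]]] := tens2_span t.
have {Px}[y Py] := choice _ Px; have {Py}[z Py] := choice _ Py.
have [m [om [e [lin_om se]]]] := finite_dual_system [seq y i | i <- enum 'I_n].
pose F j t := t2 (e j) (om_id (T2 := T2) (om j) t).
have lin_F j : islinear (F j) by rewrite /F /om_id; lin.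
suff -> : t = \sum_(j < m) F j t.
  by rewrite big1 // => j _; rewrite /F H //; apply: islinear0; lin.
rewrite {}def_t; apply: (big_ind (fun t => t = \sum_(j < m) F j t)).
- by rewrite big1 // => j _; apply: islinear0.
- move=> u v {1}-> {1}->; rewrite -big_split; apply: eq_bigr => j _ /=.
  by rewrite -(islinearD _ _ (lin_F j)).
move=> i _; rewrite Py.
rewrite {1}(se (y i)); last by apply: map_f; rewrite mem_enum.
pose G y := c i *: t2 y (z i).
have lin_G : islinear G by rewrite /G; lin.
rewrite -[LHS]/(G _) (islinear_sum _ lin_G); apply: eq_bigr => j _.
have := lin_om j => ?; rewrite (islinearZ _ _ lin_G) (islinearZ _ _ (lin_F j)) /G /F /om_id; liftE.
by rewrite (islinearZ _ _ (proj2 (tens2_bilin T2) _)) !scalerA mulrC.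
Qed.

Lemma slice3_eq0 t :
  (forall om, isfunctional om -> lift3 T3 (fun x y z => om x *: t2 y z) t = 0) ->
  t = 0.
Proof.
move=> H; have [n [c [x [Px def_t]]]] := tens3_span t.
have {Px}[y Py] := choice _ Px; have {Py}[z Py] := choice _ Py.
have {Py}[w Py] := choice _ Py.
have [m [om [e [lin_om se]]]] := finite_dual_system [seq y i | i <- enum 'I_n].
pose F j t := ext23 T3 (e j) (lift3 T3 (fun x y z => om j x *: t2 y z) t).
have lin_F j : islinear (F j) by rewrite /F /ext23; have := lin_om j; lin.
suff -> : t = \sum_(j < m) F j t.
  by rewrite big1 // => j _; rewrite /F H //; apply: islinear0; rewrite /ext23; lin.
rewrite {}def_t; apply: (big_ind (fun t => t = \sum_(j < m) F j t)).
- by rewrite big1 // => j _; apply: islinear0.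
- move=> u v {1}-> {1}->; rewrite -big_split; apply: eq_bigr => j _ /=.
  by rewrite -(islinearD _ _ (lin_F j)).
move=> i _; rewrite Py.
rewrite {1}(se (y i)); last by apply: map_f; rewrite mem_enum.
pose G y := c i *: t3 y (z i) (w i).
have lin_G : islinear G by rewrite /G; lin.
rewrite -[LHS]/(G _) (islinear_sum _ lin_G); apply: eq_bigr => j _.
have := lin_om j => ?; rewrite (islinearZ _ _ lin_G) (islinearZ _ _ (lin_F j)) /G /F; liftE.
have lin3 : islinear (ext23 (T2 := T2) T3 (e j)) by rewrite /ext23; lin.
by rewrite (islinearZ _ _ lin3) /ext23; liftE; rewrite !scalerA mulrC.
Qed.

End Legs.

(** Non-degeneracy of the multiplication is this property for the left and for the right
    multiplications. *)
Definition jointly_injective (k : fieldType) (U V : lmodType k) (I : Type)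
  (f : I -> U -> V) : Prop :=
  (forall i, islinear (f i)) /\ forall x, (forall i, f i x = 0) -> x = 0.

Section LegInjectivity.
Variables (k : fieldType) (A : lmodType k).

(** Slicing the first leg by [om] commutes with [id (x) f i], so every slice of [t] lies in the
    common kernel. *)
Lemma leg2_injective (T2 : tensor2 A) I (f : I -> A -> A) t : jointly_injective f ->
  (forall i, lift2 T2 (fun x y => tens2 T2 x (f i y)) t = 0) -> t = 0.
Proof.
move=> [lin_f inj_f] H; apply: slice2_eq0 => om lin_om; apply: inj_f => i.
have := lin_f i => ?.
transitivity (om_id (T2 := T2) om (lift2 T2 (fun x y => tens2 T2 x (f i y)) t)).
  by rewrite /om_id; text t; liftE; rewrite (islinearZ _ _ (lin_f i)).
by rewrite H; apply: islinear0; rewrite /om_id; lin.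
Qed.

Lemma leg1_injective (T2 : tensor2 A) I (f : I -> A -> A) t : jointly_injective f ->
  (forall i, lift2 T2 (fun x y => tens2 T2 (f i x) y) t = 0) -> t = 0.
Proof.
move=> Hf H; apply: (@leg2_injective (swap2 T2) _ _ _ Hf) => i.
by rewrite lift2_swap; apply: H.
Qed.

Lemma legs_injective2 (T2 : tensor2 A) I J (f : I -> A -> A) (g : J -> A -> A) t :
  jointly_injective f -> jointly_injective g ->
  (forall i j, lift2 T2 (fun x y => tens2 T2 (f i x) (g j y)) t = 0) -> t = 0.
Proof.
move=> Hf Hg H; apply: (leg2_injective Hg) => j; apply: (leg1_injective Hf) => i.
have [[lin_f _] [lin_g _]] := (Hf, Hg); have := lin_f i; have := lin_g j => ? ?.
by rewrite -[RHS](H i j); text t; liftE.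
Qed.

Lemma legs_injective3 (T2 : tensor2 A) (T3 : tensor3 A) I J K (f : I -> A -> A)
    (g : J -> A -> A) (h : K -> A -> A) t :
  jointly_injective f -> jointly_injective g -> jointly_injective h ->
  (forall i j l, lift3 T3 (fun x y z => tens3 T3 (f i x) (g j y) (h l z)) t = 0) ->
  t = 0.
Proof.
move=> Hf Hg Hh H.
have [[lin_f _] [lin_g _] [lin_h _]] := And3 Hf Hg Hh.
apply: (slice3_eq0 (T2 := T2)) => om lin_om; apply: (legs_injective2 Hg Hh) => j l.
have := lin_g j; have := lin_h l => ? ?.
(* [F t = 0] suffices because [F] commutes with slicing the first leg. For [F t] itself the third
   leg is sliced by [om'], and [f] is cancelled on the first. *)
pose F := lift3 T3 (fun x y z => tens3 T3 x (g j y) (h l z)).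
have lin_F : islinear F by rewrite /F; lin.
suff Ft : F t = 0.
  transitivity (lift3 T3 (fun x y z => om x *: tens2 T2 y z) (F t)).
    rewrite /F; text3 t; liftE; rewrite -[LHS]/(lift2 T2 (fun y z => tens2 T2 (g j y) (h l z)) _).
    have lin2 : islinear (lift2 T2 (fun y z => tens2 T2 (g j y) (h l z))) by lin.
    by rewrite (islinearZ _ _ lin2); liftE.
  by rewrite Ft; apply: islinear0; lin.
apply: (@slice3_eq0 _ _ (swap2 T2) (swap3 T3)) => om' lin_om'.
rewrite lift3_swap; apply: (@leg1_injective T2 _ _ _ Hf) => i; have := lin_f i => ?.
transitivity (lift3 T3 (fun x y z => om' z *: tens2 T2 x y)
    (lift3 T3 (fun x y z => tens3 T3 (f i x) y z) (F t))); last first.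
  rewrite (_ : lift3 _ _ (F t) = 0); first by apply: islinear0; lin.
  by rewrite -[RHS](H i j l) /F; text3 t; liftE.
move: (F t) => u; change (tens2 (swap2 T2)) with (fun a b => tens2 T2 b a); text3 u; liftE.
have lin2 : islinear (lift2 T2 (fun x y => tens2 T2 (f i x) y)) by lin.
by rewrite (islinearZ _ _ lin2); liftE.
Qed.

End LegInjectivity.

(** * Extension of multiplicative maps to multipliers *)

Section Extension.
Variables (k : fieldType) (B C : lmodType k).

(** [gL b c] and [gR b c] stand for [gamma(b) c] and [c gamma(b)], and [eL], [eR] for the two
    multiplications by [e]. The absorption and span fields together express [<gamma(B) C> = e C] and
    [<C gamma(B)> = C e]. *)
Record extension_data (mulB : B -> B -> B) (mulC : C -> C -> C)
    (gL gR : B -> C -> C) (eL eR : C -> C) : Prop := ExtensionData {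
  ext_mulC : isbilinear mulC;
  ext_gL : isbilinear gL;
  ext_gR : isbilinear gR;
  ext_eL : islinear eL;
  ext_eR : islinear eR;
  ext_ndl : forall y, (forall x, mulC x y = 0) -> y = 0;
  ext_ndr : forall y, (forall x, mulC y x = 0) -> y = 0;
  ext_g : forall b x y, mulC x (gL b y) = mulC (gR b x) y;
  ext_gLM : forall a b c, gL (mulB a b) c = gL a (gL b c);
  ext_gRM : forall a b c, gR (mulB a b) c = gR b (gR a c);
  ext_e : forall x y, mulC x (eL y) = mulC (eR x) y;
  ext_eLgL : forall b c, eL (gL b c) = gL b c;
  ext_eRgR : forall b c, eR (gR b c) = gR b c;
  ext_spanL : forall c, Defs.span (fun x => exists b c', x = gL b c') (eL c);
  ext_spanR : forall c, Defs.span (fun x => exists b c', x = gR b c') (eR c) }.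

(** Thanks to this symmetry each right-handed statement below is the left-handed one for the
    opposite algebras. *)
Lemma extension_data_op mulB mulC gL gR eL eR :
  extension_data mulB mulC gL gR eL eR ->
  extension_data (fun x y => mulB y x) (fun x y => mulC y x) gR gL eR eL.
Proof. by case=> [[? ?]] *; split. Qed.

(* The value of the extension of [g] on a multiplier with right component [r]:
   [G(m) c] is the unique [z] in [e C] with [gamma(b) z = gamma(b m) c]. *)
Definition ext_char (gL : B -> C -> C) (eL : C -> C) (r : B -> B) (c z : C) :=
  eL z = z /\ forall b, gL b z = gL (r b) c.
Definition ext_val gL eL r c := epsilon (inhabits 0) (ext_char gL eL r c).

Section Half.
Variables (mulB : B -> B -> B) (mulC : C -> C -> C) (gL gR : B -> C -> C) (eL eR : C -> C).
Hypothesis X : extension_data mulB mulC gL gR eL eR.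

(** Tested by multiplying with [x] on the left: then [e] acts on [x gamma(b)], which absorbs it. *)
Lemma ext_gLeL b c : gL b (eL c) = gL b c.
Proof.
have bm := ext_mulC X; apply/eqP; rewrite -subr_eq0; apply/eqP.
apply: (ext_ndl X) => x; rewrite (islinearB _ _ (proj2 bm x)).
by rewrite !(ext_g X) (ext_e X) (ext_eRgR X) subrr.
Qed.

(** From [e c = sum a_i gamma(b_i) d_i] the candidate for [G(m) c] is [sum a_i gamma(m b_i) d_i];
    applying [gamma(b)] gives [gamma(b m) e c], because [b (m b_i) = (b m) b_i]. *)
Lemma ext_char_witness l r c n (a : 'I_n -> k) (b : 'I_n -> B) (d : 'I_n -> C) :
  (forall x y, mulB x (l y) = mulB (r x) y) ->
  eL c = \sum_(i < n) a i *: gL (b i) (d i) ->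
  ext_char gL eL r c (\sum_(i < n) a i *: gL (l (b i)) (d i)).
Proof.
move=> lr def_c; have [b1 b2] := ext_gL X; split=> [|b0].
  rewrite (islinear_sum _ (ext_eL X)); apply: eq_bigr => i _.
  by rewrite (islinearZ _ _ (ext_eL X)) (ext_eLgL X).
rewrite -(ext_gLeL (r b0)) def_c !(islinear_sum _ (b2 _)); apply: eq_bigr => i _.
by rewrite !(islinearZ _ _ (b2 _)) -!(ext_gLM X) lr.
Qed.

Lemma span_gL c : exists (n : nat) (a : 'I_n -> k) (b : 'I_n -> B) (d : 'I_n -> C),
  eL c = \sum_(i < n) a i *: gL (b i) (d i).
Proof.
have [n [a [x [Px ->]]]] := ext_spanL X c.
have {Px}[b Pb] := choice _ Px; have {Pb}[d Pd] := choice _ Pb.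
by exists n, a, b, d; apply: eq_bigr => i _; rewrite Pd.
Qed.

Lemma ext_valP l r c : (forall x y, mulB x (l y) = mulB (r x) y) ->
  ext_char gL eL r c (ext_val gL eL r c).
Proof.
move=> lr; apply: (epsilon_spec (inhabits 0) (ext_char gL eL r c)).
have [n [a [b [d def_c]]]] := span_gL c.
by eexists; apply: ext_char_witness def_c.
Qed.

End Half.

Section HalfUnique.
Variables (mulB : B -> B -> B) (mulC : C -> C -> C) (gL gR : B -> C -> C) (eL eR : C -> C).
Hypothesis X : extension_data mulB mulC gL gR eL eR.

(** The difference of two solutions lies in [e C] and is killed by all [gamma(b)]. Its left product
    with [x] is one with [x e], a combination of elements [d gamma(b)], hence vanishes. *)
Lemma ext_char_unique r c z z' :
  ext_char gL eL r c z -> ext_char gL eL r c z' -> z = z'.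
Proof.
move=> [ez gz] [ez' gz']; have bm := ext_mulC X.
apply/eqP; rewrite -subr_eq0; apply/eqP; apply: (ext_ndl X) => x.
rewrite (islinearB _ _ (proj2 bm x)) -ez -ez' !(ext_e X).
have [n [a [b [d ->]]]] := span_gL (extension_data_op X) x.
rewrite -(islinearB _ _ (proj2 bm _)).
rewrite (islinear_sum _ (proj1 bm _)) big1 // => i _.
rewrite (islinearZ _ _ (proj1 bm _)) -(ext_g X) (islinearB _ _ (proj2 (ext_gL X) _)).
by rewrite gz gz' subrr (islinear0 (proj2 bm _)) scaler0.
Qed.

Lemma ext_valE l r c z : (forall x y, mulB x (l y) = mulB (r x) y) ->
  ext_char gL eL r c z -> ext_val gL eL r c = z.
Proof. by move=> lr; apply: ext_char_unique (ext_valP X c lr). Qed.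

(** This and the next rules follow one pattern: the expected value satisfies [ext_char], and
    uniqueness identifies it with [ext_val]. *)
Lemma ext_val_linear l r :
  (forall x y, mulB x (l y) = mulB (r x) y) -> islinear (ext_val gL eL r).
Proof.
move=> lr c x y; have [ex gx] := ext_valP X x lr; have [ey gy] := ext_valP X y lr.
apply: (ext_valE lr); split=> [|b]; first by rewrite (ext_eL X) ex ey.
by rewrite !(proj2 (ext_gL X) _ _ _ _) gx gy.
Qed.

Lemma ext_val_comp l r l' r' c : (forall x y, mulB x (l y) = mulB (r x) y) ->
  (forall x y, mulB x (l' y) = mulB (r' x) y) ->
  ext_val gL eL (fun x => r' (r x)) c = ext_val gL eL r (ext_val gL eL r' c).
Proof.
move=> lr lr'; apply: (ext_valE (l := fun x => l (l' x))) => [x y|].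
  by rewrite lr lr'.
have [e1 g1] := ext_valP X (ext_val gL eL r' c) lr.
have [e2 g2] := ext_valP X c lr'.
by split=> // b; rewrite g1 g2.
Qed.

Lemma ext_val_add l r l' r' a c : isbilinear mulB ->
  (forall x y, mulB x (l y) = mulB (r x) y) ->
  (forall x y, mulB x (l' y) = mulB (r' x) y) ->
  ext_val gL eL (fun x => a *: r x + r' x) c =
    a *: ext_val gL eL r c + ext_val gL eL r' c.
Proof.
move=> [bB1 bB2] lr lr'.
apply: (ext_valE (l := fun x => a *: l x + l' x)) => [x y|].
  by rewrite bB1 bB2 lr lr'.
have [e1 g1] := ext_valP X c lr; have [e2 g2] := ext_valP X c lr'.
split=> [|b]; first by rewrite (ext_eL X) e1 e2.
by rewrite (proj2 (ext_gL X)) (proj1 (ext_gL X)) g1 g2.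
Qed.

Lemma ext_val_iota b c : (forall x y z, mulB x (mulB y z) = mulB (mulB x y) z) ->
  ext_val gL eL (fun x => mulB x b) c = gL b c.
Proof.
move=> assoc; apply: (ext_valE (l := mulB b)) => [x y|]; first exact: assoc.
by split=> [|x]; rewrite ?(ext_eLgL X) // (ext_gLM X).
Qed.

Lemma ext_val_one c : ext_val gL eL id c = eL c.
Proof.
apply: (ext_valE (l := id)) => //; split=> [|x]; last exact: (ext_gLeL X).
have [n [a [b [d ->]]]] := span_gL X c.
rewrite (islinear_sum _ (ext_eL X)); apply: eq_bigr => i _.
by rewrite (islinearZ _ _ (ext_eL X)) (ext_eLgL X).
Qed.

End HalfUnique.

Variables (mulB : B -> B -> B) (mulC : C -> C -> C) (gL gR : B -> C -> C) (eL eR : C -> C).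
Hypothesis X : extension_data mulB mulC gL gR eL eR.
Hypothesis bil_mulB : isbilinear mulB.
Hypothesis assoc_mulB : forall x y z, mulB x (mulB y z) = mulB (mulB x y) z.

(** The left action of [G(m)] is built from right multiplication by [m], and conversely, as in
    [ext_char]. Axiom (v) speaks about all extensions, so one must be exhibited before it can be
    applied. *)
Definition mult_ext (m : mult B) : mult C :=
  (ext_val gL eL m.2, ext_val gR eR m.1).

Let Xop := extension_data_op X.

Lemma mult_ext_is_mult m : is_mult mulB m -> is_mult mulC (mult_ext m).
Proof.
case=> lin1 lin2 m12; have m21 x y : mulB (m.2 y) x = mulB y (m.1 x) by rewrite m12.
split=> [||x y].
- exact: (ext_val_linear X m12).
- exact: (ext_val_linear Xop m21).
(* [x e] is a combination of elements [d gamma(b)], on which [G(m)] acts from the right by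
   [d gamma(b m)]. *)
have [n [a [b [d def_x]]]] := span_gL Xop x.
have [ez gz] := ext_valP X y m12.
rewrite /= (ext_valE Xop m21 (ext_char_witness Xop m21 def_x)) -ez (ext_e X) def_x.
have bm := ext_mulC X.
rewrite !(islinear_sum _ (proj1 bm _)); apply: eq_bigr => i _.
by rewrite !(islinearZ _ _ (proj1 bm _)) -!(ext_g X) gz.
Qed.

Lemma mult_extM m n : is_mult mulB m -> is_mult mulB n ->
  mult_ext (mmul m n) = mmul (mult_ext m) (mult_ext n).
Proof.
move=> [_ _ m12] [_ _ n12]; congr pair; apply: boolp.funext => c /=.
  exact: (ext_val_comp X c m12 n12).
have m21 x y : mulB (m.2 y) x = mulB y (m.1 x) by rewrite m12.
have n21 x y : mulB (n.2 y) x = mulB y (n.1 x) by rewrite n12.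
exact: (ext_val_comp Xop c n21 m21).
Qed.

Lemma mult_ext_linear a m n : is_mult mulB m -> is_mult mulB n ->
  mult_ext (madd (mscale a m) n) = madd (mscale a (mult_ext m)) (mult_ext n).
Proof.
move=> [_ _ m12] [_ _ n12]; congr pair; apply: boolp.funext => c /=.
  exact: (ext_val_add X a c bil_mulB m12 n12).
have m21 x y : mulB (m.2 y) x = mulB y (m.1 x) by rewrite m12.
have n21 x y : mulB (n.2 y) x = mulB y (n.1 x) by rewrite n12.
have bil_op : isbilinear (fun x y => mulB y x) by case: bil_mulB; split.
exact: (ext_val_add Xop a c bil_op m21 n21).
Qed.

Lemma mult_ext_iota b : mult_ext (iota mulB b) = (gL b, gR b).
Proof.
congr pair; apply: boolp.funext => c /=; first exact: (ext_val_iota X).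
by apply: (ext_val_iota Xop) => x y z; rewrite assoc_mulB.
Qed.

Lemma mult_ext_one : mult_ext (mone B) = (eL, eR).
Proof.
by congr pair; apply: boolp.funext => c /=; rewrite ?(ext_val_one X) ?(ext_val_one Xop).
Qed.

End Extension.

(** * The canonical idempotent under the extended comultiplication *)

Record nondegenerate_algebra (k : fieldType) (A : lmodType k) (mu : A -> A -> A) : Prop :=
  NondegenerateAlgebra {
  alg_bil : isbilinear mu;
  alg_assoc : forall a b c, mu (mu a b) c = mu a (mu b c);
  alg_idem : forall a, Defs.span (fun x => exists b c, x = mu b c) a;
  alg_ndl : forall b, (forall a, mu a b = 0) -> b = 0;
  alg_ndr : forall b, (forall a, mu b a = 0) -> b = 0 }.

Section MulTensor.
Variables (k : fieldType) (A : lmodType k) (T2 : tensor2 A) (T3 : tensor3 A).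
Variable mu : A -> A -> A.
Hypothesis HA : nondegenerate_algebra mu.
Local Notation t2 := (tens2 T2).
Local Notation t3 := (tens3 T3).
Local Notation mul2 := (mul2 (T2 := T2) mu).
Local Notation mul3 := (mul3 (T3 := T3) mu).

Let bm : isbilinear mu := alg_bil HA.

Lemma alg_injl : jointly_injective mu.
Proof. by split=> [i|]; [case: bm | apply: (alg_ndl HA)]. Qed.

Lemma alg_injr : jointly_injective (fun a x => mu x a).
Proof. by split=> [i|]; [case: bm | apply: (alg_ndr HA)]. Qed.

Lemma mul2_bil : isbilinear mul2.
Proof. by rewrite /Defs.mul2; lin. Qed.

Lemma mul2E a b c d : mul2 (t2 a b) (t2 c d) = t2 (mu a c) (mu b d).
Proof. by rewrite /Defs.mul2; liftE. Qed.

Lemma mul2A s t u : mul2 (mul2 s t) u = mul2 s (mul2 t u).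
Proof.
have ? := mul2_bil.
by text s; text t; text u; rewrite !mul2E !(alg_assoc HA).
Qed.

Lemma mul2_ndl t : (forall s, mul2 s t = 0) -> t = 0.
Proof.
move=> H; apply: (legs_injective2 alg_injl alg_injl) => i j.
by rewrite -[RHS](H (t2 i j)) /Defs.mul2; liftE.
Qed.

Lemma mul2_ndr t : (forall s, mul2 t s = 0) -> t = 0.
Proof.
move=> H; apply: (legs_injective2 alg_injr alg_injr) => i j.
by rewrite -[RHS](H (t2 i j)) /Defs.mul2; text t; liftE.
Qed.

Lemma mul2_cancell t t' : (forall s, mul2 s t = mul2 s t') -> t = t'.
Proof.
move=> H; apply/eqP; rewrite -subr_eq0; apply/eqP; apply: mul2_ndl => s.
by rewrite (islinearB _ _ (proj2 mul2_bil s)) H subrr.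
Qed.

Lemma mul2_cancelr t t' : (forall s, mul2 t s = mul2 t' s) -> t = t'.
Proof.
move=> H; apply/eqP; rewrite -subr_eq0; apply/eqP; apply: mul2_ndr => s.
by rewrite (islinearB _ _ (proj1 mul2_bil s)) H subrr.
Qed.

Lemma mul3_bil : isbilinear mul3.
Proof. by rewrite /Defs.mul3; lin. Qed.

Lemma mul3_ndl t : (forall s, mul3 s t = 0) -> t = 0.
Proof.
move=> H; apply: (legs_injective3 T2 alg_injl alg_injl alg_injl) => i j l.
by rewrite -[RHS](H (t3 i j l)) /Defs.mul3; liftE.
Qed.

Lemma mul3_ndr t : (forall s, mul3 t s = 0) -> t = 0.
Proof.
move=> H; apply: (legs_injective3 T2 alg_injr alg_injr alg_injr) => i j l.
by rewrite -[RHS](H (t3 i j l)) /Defs.mul3; text3 t; liftE.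
Qed.

Local Notation ext12 := (ext12 (T2 := T2) T3).
Local Notation ext23 := (ext23 (T2 := T2) T3).

Lemma ext12_bil : isbilinear ext12.
Proof. by rewrite /Defs.ext12; lin. Qed.

Lemma ext23_bil : isbilinear ext23.
Proof. by rewrite /Defs.ext23; lin. Qed.

Lemma ext12E x y z : ext12 (t2 x y) z = t3 x y z.
Proof. by rewrite /Defs.ext12; liftE. Qed.

Lemma ext23E x y z : ext23 x (t2 y z) = t3 x y z.
Proof. by rewrite /Defs.ext23; liftE. Qed.

Lemma mul3_ext12 s t c d : mul3 (ext12 s c) (ext12 t d) = ext12 (mul2 s t) (mu c d).
Proof.
have ? := mul3_bil; have ? := mul2_bil; have ? := ext12_bil.
by text s; text t; rewrite mul2E !ext12E /Defs.mul3; liftE.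
Qed.

Lemma ext12_ext (W : lmodType k) (f g : tt3 T3 -> W) : islinear f -> islinear g ->
  (forall s z, f (ext12 s z) = g (ext12 s z)) -> forall t, f t = g t.
Proof. by move=> Hf Hg H; apply: tens3_ext => // a b c; rewrite -ext12E H. Qed.

(** The operator [F (x) g] on [(A (x) A) (x) A]; [E (x) 1] and the actions of [Delta(a) (x) b] have
    this shape. *)
Definition map12 (F : tt2 T2 -> tt2 T2) (g : A -> A) : tt3 T3 -> tt3 T3 :=
  lift3 T3 (fun x y z => ext12 (F (t2 x y)) (g z)).

Lemma map12_linear F g : islinear F -> islinear g -> islinear (map12 F g).
Proof. by move=> ? ?; have ? := ext12_bil; rewrite /map12; lin. Qed.

Lemma map12E F g s z : islinear F -> islinear g ->
  map12 F g (ext12 s z) = ext12 (F s) (g z).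
Proof.
move=> ? ?; have ? := map12_linear (F := F) (g := g); have ? := ext12_bil.
have ? : islinear (map12 F g) by auto.
by text s; rewrite ext12E /map12; liftE.
Qed.

End MulTensor.

#[global] Hint Resolve ext12_bil ext23_bil : lin.

Ltac text12 T2 t :=
  pattern t;
  match goal with
  | |- (fun x => @?L x = @?R x) t =>
      refine (@ext12_ext _ _ T2 _ _ L R _ _ _ t); [lin | lin | intros; cbv beta]
  end.

(** [EL], [ER] and [DL], [DR] are left and right multiplication by [E] and by [Delta(a)]. The fields
    are what the extension of [Delta (x) id] requires, in a form stable under [swap2]. *)
Record comult_data (k : fieldType) (A : lmodType k) (T2 : tensor2 A)
    (mu : A -> A -> A) (EL ER : tt2 T2 -> tt2 T2) (DL DR : A -> tt2 T2 -> tt2 T2) : Prop :=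
  ComultData {
  cm_alg : nondegenerate_algebra mu;
  cm_EL : islinear EL;
  cm_ER : islinear ER;
  cm_E : forall s t, mul2 mu s (EL t) = mul2 mu (ER s) t;
  cm_DL : isbilinear DL;
  cm_DR : isbilinear DR;
  cm_D : forall a s t, mul2 mu s (DL a t) = mul2 mu (DR a s) t;
  cm_DLM : forall a b s, DL (mu a b) s = DL a (DL b s);
  cm_DRM : forall a b s, DR (mu a b) s = DR b (DR a s);
  cm_ELDL : forall a s, EL (DL a s) = DL a s;
  cm_ERDR : forall a s, ER (DR a s) = DR a s;
  cm_spanL : forall s, Defs.span (fun x => exists a s', x = DL a s') (EL s);
  cm_spanR : forall s, Defs.span (fun x => exists a s', x = DR a s') (ER s) }.

Section ComultExtension.
Variables (k : fieldType) (A : lmodType k) (T2 : tensor2 A) (T3 : tensor3 A).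
Variable mu : A -> A -> A.
Variables (EL ER : tt2 T2 -> tt2 T2) (DL DR : A -> tt2 T2 -> tt2 T2).
Hypothesis H : comult_data mu EL ER DL DR.
Let E : mult (tt2 T2) := (EL, ER).
Let Delta a : mult (tt2 T2) := (DL a, DR a).
Local Notation t2 := (tens2 T2).
Local Notation t3 := (tens3 T3).
Local Notation ext12 := (ext12 (T2 := T2) T3).
Local Notation ext23 := (ext23 (T2 := T2) T3).
Local Notation mul2 := (mul2 (T2 := T2) mu).
Local Notation mul3 := (mul3 (T3 := T3) mu).
Local Notation gamma := (Delta_id T3 mu Delta).

Let HA := cm_alg H.
Let bm : isbilinear mu := alg_bil HA.
Let lin_EL := cm_EL H.
Let lin_ER := cm_ER H.
Let bDL := cm_DL H.
Let bDR := cm_DR H.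

Definition gammaL (t : tt2 T2) (X : tt3 T3) := lift2 T2 (fun a b => (gamma a b).1 X) t.
Definition gammaR (t : tt2 T2) (X : tt3 T3) := lift2 T2 (fun a b => (gamma a b).2 X) t.

Lemma gammaL_bil : isbilinear gammaL.
Proof. by rewrite /gammaL /Delta_id /=; lin. Qed.

Lemma gammaR_bil : isbilinear gammaR.
Proof. by rewrite /gammaR /Delta_id /=; lin. Qed.

Lemma gammaLE a b X : gammaL (t2 a b) X = (gamma a b).1 X.
Proof. by rewrite /gammaL /Delta_id /=; liftE. Qed.

Lemma gammaRE a b X : gammaR (t2 a b) X = (gamma a b).2 X.
Proof. by rewrite /gammaR /Delta_id /=; liftE. Qed.

Lemma gammaL_ext12 a b s z : gammaL (t2 a b) (ext12 s z) = ext12 (DL a s) (mu b z).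
Proof. by rewrite gammaLE; apply: (map12E T3 (F := DL a) (g := mu b)); lin. Qed.

Lemma gammaR_ext12 a b s z : gammaR (t2 a b) (ext12 s z) = ext12 (DR a s) (mu z b).
Proof. by rewrite gammaRE; apply: (map12E T3 (F := DR a) (g := fun z => mu z b)); lin. Qed.

Lemma E_one_ext12 s z : (E_one T3 E).1 (ext12 s z) = ext12 (EL s) z.
Proof. by apply: (map12E T3 (F := EL) (g := fun z => z)); lin. Qed.

Lemma E_one_ext12r s z : (E_one T3 E).2 (ext12 s z) = ext12 (ER s) z.
Proof. by apply: (map12E T3 (F := ER) (g := fun z => z)); lin. Qed.

Lemma E_one_linl : islinear (E_one T3 E).1.
Proof. by rewrite /E_one /=; lin. Qed.

Lemma E_one_linr : islinear (E_one T3 E).2.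
Proof. by rewrite /E_one /=; lin. Qed.

(** Identities are checked on [s (x) z] with [s] in [A (x) A]. The span conditions come from axiom
    (iv) on the first two legs and from idempotence of [A] on the third. *)
Lemma Delta_id_extension_data :
  extension_data mul2 mul3 gammaL gammaR (E_one T3 E).1 (E_one T3 E).2.
Proof.
have b3 := mul3_bil T3 HA; have b2 := mul2_bil T2 HA.
have bL := gammaL_bil; have bR := gammaR_bil.
have eL := E_one_linl; have eR := E_one_linr.
split=> //.
- exact: (mul3_ndl T2 HA).
- exact: (mul3_ndr T2 HA).
- move=> b x y; text b; text12 T2 x; text12 T2 y.
  by rewrite gammaL_ext12 gammaR_ext12 !(mul3_ext12 _ HA) (cm_D H) (alg_assoc HA).
- move=> a b c; text a; text b; text12 T2 c.
  by rewrite (mul2E _ HA) !gammaL_ext12 (cm_DLM H) (alg_assoc HA).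
- move=> a b c; text a; text b; text12 T2 c.
  by rewrite (mul2E _ HA) !gammaR_ext12 (cm_DRM H) (alg_assoc HA).
- move=> x y; text12 T2 x; text12 T2 y.
  by rewrite E_one_ext12 E_one_ext12r !(mul3_ext12 _ HA) (cm_E H).
- by move=> b c; text b; text12 T2 c; rewrite gammaL_ext12 E_one_ext12 (cm_ELDL H).
- by move=> b c; text b; text12 T2 c; rewrite gammaR_ext12 E_one_ext12r (cm_ERDR H).
- set P := fun _ => _; have sP := span_subspace P.
  apply: tens3_ind => [|x y z]; first exact: subspace_preim.
  rewrite -(ext12E T2) E_one_ext12.
  apply: (span_min (S := fun u => Defs.span P (ext12 u z)) _ _ (cm_spanL H (t2 x y)))
    => [|_ [a [s ->]]].
    by apply: (subspace_preim (f := fun u => ext12 u z)) => //; lin.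
  apply: (span_min (S := fun z => Defs.span P (ext12 _ z)) _ _ (alg_idem HA z)) => [|_ [b [c ->]]].
    by apply: (subspace_preim (f := fun u => ext12 _ u)) => //; lin.
  by apply: span_mem; exists (t2 a b), (ext12 s c); rewrite gammaL_ext12.
- set P := fun _ => _; have sP := span_subspace P.
  apply: tens3_ind => [|x y z]; first exact: subspace_preim.
  rewrite -(ext12E T2) E_one_ext12r.
  apply: (span_min (S := fun u => Defs.span P (ext12 u z)) _ _ (cm_spanR H (t2 x y)))
    => [|_ [a [s ->]]].
    by apply: (subspace_preim (f := fun u => ext12 u z)) => //; lin.
  apply: (span_min (S := fun z => Defs.span P (ext12 _ z)) _ _ (alg_idem HA z)) => [|_ [b [c ->]]].
    by apply: (subspace_preim (f := fun u => ext12 _ u)) => //; lin.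
  by apply: span_mem; exists (t2 a c), (ext12 s b); rewrite gammaR_ext12.
Qed.

Hypothesis E3 : forall G, is_mult_ext mu (Delta_id T3 mu Delta) (E_one T3 E) G ->
  G E = mmul (E_one T3 E) (one_E T3 E) /\ G E = mmul (one_E T3 E) (E_one T3 E).

Lemma E_is_mult : is_mult mul2 E.
Proof. by split=> //; apply: (cm_E H). Qed.

Lemma iotaE s : mmul (iota mul2 s) E = iota mul2 (ER s).
Proof.
congr pair; apply: boolp.funext => x /=; first exact: (cm_E H).
apply: (mul2_cancelr HA) => y; rewrite -(cm_E H) !(mul2A HA).
by rewrite (cm_E H).
Qed.

Lemma Eiota s : mmul E (iota mul2 s) = iota mul2 (EL s).
Proof.
congr pair; apply: boolp.funext => x /=; last by rewrite (cm_E H).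
apply: (mul2_cancell HA) => y; rewrite (cm_E H) -!(mul2A HA).
by rewrite (cm_E H).
Qed.

Lemma iota_is_mult s : is_mult mul2 (iota mul2 s).
Proof.
by have [? ?] := mul2_bil T2 HA; split=> //= x y; rewrite (mul2A HA).
Qed.

Let X := Delta_id_extension_data.
Let G := mult_ext gammaL gammaR (E_one T3 E).1 (E_one T3 E).2.

Lemma G_is_mult_ext : is_mult_ext mu (Delta_id T3 mu Delta) (E_one T3 E) G.
Proof.
have assoc x y z := esym (mul2A (T2 := T2) HA x y z).
split.
- exact: (mult_ext_is_mult X).
- exact: (mult_extM X).
- exact: (mult_ext_linear X (mul2_bil T2 HA)).
- move=> a b; rewrite /G (mult_ext_iota X assoc).
  by congr pair; apply: boolp.funext => c; rewrite ?gammaLE ?gammaRE.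
- exact: (mult_ext_one X).
Qed.

(** Multiplicativity of the extension gives [G(s E) = gamma(s) (E (x) 1) (1 (x) E)], and [gamma(s)]
    absorbs [E (x) 1]. *)
Lemma gammaR_E s Y : (one_E T3 E).2 (gammaR s Y) = gammaR (ER s) Y.
Proof.
have assoc x y z := esym (mul2A (T2 := T2) HA x y z).
have GM := mult_extM X (iota_is_mult s) E_is_mult.
rewrite iotaE !(mult_ext_iota X assoc) in GM.
have [GE _] := E3 G_is_mult_ext; rewrite /G in GE; rewrite GE in GM.
have GY : gammaR (ER s) Y = (one_E T3 E).2 ((E_one T3 E).2 (gammaR s Y)).
  exact: (f_equal (fun m => m.2 Y) GM).
by rewrite GY (ext_eRgR X).
Qed.

Lemma gammaL_E s Y : (one_E T3 E).1 (gammaL s Y) = gammaL (EL s) Y.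
Proof.
have assoc x y z := esym (mul2A (T2 := T2) HA x y z).
have GM := mult_extM X E_is_mult (iota_is_mult s).
rewrite Eiota !(mult_ext_iota X assoc) in GM.
(* The other order of the factors of [E^(3)] is taken, so that [E (x) 1] stands next to
   [gamma(s)]. *)
have [_ GE] := E3 G_is_mult_ext; rewrite /G in GE; rewrite GE in GM.
have GY : gammaL (EL s) Y = (one_E T3 E).1 ((E_one T3 E).1 (gammaL s Y)).
  exact: (f_equal (fun m => m.1 Y) GM).
by rewrite GY (ext_eLgL X).
Qed.

(* [(s (x) u) (Delta(z) (x) c) (1 (x) E) = (s (x) u) (Delta (x) id)((z (x) c) E)]; the
   factor [E (x) 1] of [E^(3)] is absorbed by [Delta(z)]. *)
Lemma coproduct_E_right z c s u :
  lift2 T2 (fun p q => ext23 p (ER (t2 q (mu u c)))) (DR z s) =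
  lift2 T2 (fun a b => ext12 (DR a s) (mu u b)) (ER (t2 z c)).
Proof.
have ? := gammaR_bil.
transitivity (gammaR (ER (t2 z c)) (ext12 s u)); last first.
  by move: (ER _) => t; text t; liftE; rewrite gammaR_ext12.
rewrite -gammaR_E gammaR_ext12; move: (DR z s) => t.
by rewrite /one_E /=; text t; rewrite (ext12E T2); liftE.
Qed.

(** Mirror image: [(1 (x) E) (Delta(z) (x) c) (s (x) u) = (Delta (x) id)(E (z (x) c)) (s (x) u)]. *)
Lemma coproduct_E_left z c s u :
  lift2 T2 (fun p q => ext23 p (EL (t2 q (mu c u)))) (DL z s) =
  lift2 T2 (fun a b => ext12 (DL a s) (mu b u)) (EL (t2 z c)).
Proof.
have ? := gammaL_bil.
transitivity (gammaL (EL (t2 z c)) (ext12 s u)); last first.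
  by move: (EL _) => t; text t; liftE; rewrite gammaL_ext12.
rewrite -gammaL_E gammaL_ext12; move: (DL z s) => t.
by rewrite /one_E /=; text t; rewrite (ext12E T2); liftE.
Qed.

End ComultExtension.

(** * Linear maps acting on one leg of a tensor *)

Section Legs12.
Variables (k : fieldType) (A : lmodType k) (T : tensor2 A).
Definition leg1 (f : A -> A) : tt2 T -> tt2 T := lift2 T (fun x y => tens2 T (f x) y).
Definition leg2 (f : A -> A) : tt2 T -> tt2 T := lift2 T (fun x y => tens2 T x (f y)).

Lemma leg1_linear f : islinear f -> islinear (leg1 f).
Proof. by move=> ?; rewrite /leg1; lin. Qed.

Lemma leg2_linear f : islinear f -> islinear (leg2 f).
Proof. by move=> ?; rewrite /leg2; lin. Qed.

Lemma leg1E f a b : islinear f -> leg1 f (tens2 T a b) = tens2 T (f a) b.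
Proof. by move=> ?; rewrite /leg1; liftE. Qed.

Lemma leg2E f a b : islinear f -> leg2 f (tens2 T a b) = tens2 T a (f b).
Proof. by move=> ?; rewrite /leg2; liftE. Qed.

Lemma leg2_cancel I (f : I -> A -> A) t t' : jointly_injective f ->
  (forall i, leg2 (f i) t = leg2 (f i) t') -> t = t'.
Proof.
move=> Hf H; apply/eqP; rewrite -subr_eq0; apply/eqP; apply: (leg2_injective Hf) => i.
by rewrite -/(leg2 (f i) _) (islinearB _ _ (leg2_linear (proj1 Hf i))) H subrr.
Qed.

End Legs12.

Lemma cancel_family (k : fieldType) (U V : lmodType k) I (f : I -> U -> V) x y :
  jointly_injective f -> (forall i, f i x = f i y) -> x = y.
Proof.
move=> [lf Hf] H; apply/eqP; rewrite -subr_eq0; apply/eqP; apply: Hf => i.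
by rewrite (islinearB _ _ (lf i)) H subrr.
Qed.

Lemma leg1_swap (k : fieldType) (A : lmodType k) (T : tensor2 A) f :
  leg1 (T := swap2 T) f = leg2 (T := T) f.
Proof. by rewrite /leg1 lift2_swap. Qed.

Lemma leg2_swap (k : fieldType) (A : lmodType k) (T : tensor2 A) f :
  leg2 (T := swap2 T) f = leg1 (T := T) f.
Proof. by rewrite /leg2 lift2_swap. Qed.

Ltac tensor t :=
  rewrite /leg1 /leg2 /eps_id /id_eps /id_om /om_id; text t; liftE.

(** * The counit applied to the middle leg of [E^(3)] *)

(* Used with [nu = mu], [e] = right multiplication by [E], [D] = right multiplication
   by [Delta], [S = T2], and with the variants obtained by replacing [A] by its
   opposite algebra or its opposite coalgebra. *)
Section CounitOfCoproductE.
Variables (k : fieldType) (A : lmodType k) (T2 : tensor2 A) (T3 : tensor3 A).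
Variables (nu : A -> A -> A) (e : tt2 T2 -> tt2 T2) (D : A -> tt2 T2 -> tt2 T2).
Variables (S : A -> A -> tt2 T2) (eps : A -> k).
Local Notation t2 := (tens2 T2).
Local Notation ext12 := (ext12 (T2 := T2) T3).
Local Notation ext23 := (ext23 (T2 := T2) T3).
Hypotheses (bnu : isbilinear nu) (nu_inj : jointly_injective nu).
Hypotheses (lin_e : islinear e) (bD : isbilinear D) (bS : isbilinear S).
Hypothesis lin_eps : isfunctional eps.
Hypothesis SD : forall h v w z, leg1 (nu h) (leg2 (nu v) (S w z)) = D z (t2 (nu h w) v).
Hypothesis e1 : forall h t, e (leg1 (nu h) t) = leg1 (nu h) (e t).
Hypothesis e2 : forall h t, e (leg2 (nu h) t) = leg2 (nu h) (e t).
Hypothesis eD : forall z c s u,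
  lift2 T2 (fun p q => ext23 p (e (t2 q (nu u c)))) (D z s) =
  lift2 T2 (fun a b => ext12 (D a s) (nu u b)) (e (t2 z c)).
Hypothesis epsS : forall w z, id_eps eps (S w z) = nu w z.

(** For [nu = mu], left multiplication by [h (x) v (x) u] turns [S w z] into [D z] applied to
    [h w (x) v], where [eD] is available; these factors cancel by non-degeneracy. *)
Lemma coproduct_E_elements w z c :
  lift2 T2 (fun p q => ext23 p (e (t2 q c))) (S w z) =
  lift2 T2 (fun s r => ext12 (S w s) r) (e (t2 z c)).
Proof.
apply/eqP; rewrite -subr_eq0; apply/eqP.
apply: (legs_injective3 T2 nu_inj nu_inj nu_inj) => h v u.
set N := lift3 _ _; have lin_N : islinear N by rewrite /N; lin.
rewrite (islinearB _ _ lin_N); apply/eqP; rewrite subr_eq0; apply/eqP.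
have N23 p t : N (ext23 p t) = ext23 (nu h p) (leg1 (nu v) (leg2 (nu u) t)).
  have ? := ext23_bil T2 T3.
  by tensor t; rewrite !ext23E /N; liftE.
have N12 r t : N (ext12 t r) = ext12 (leg1 (nu h) (leg2 (nu v) t)) (nu u r).
  have ? := ext12_bil T2 T3.
  by tensor t; rewrite !ext12E /N; liftE.
transitivity (lift2 T2 (fun p q => ext23 p (e (t2 q (nu u c))))
    (leg1 (nu h) (leg2 (nu v) (S w z)))).
  by move: (S w z) => t; tensor t; rewrite N23 -e2 -e1 leg2E ?leg1E //; lin.
rewrite SD eD; move: (e _) => t.
by tensor t; rewrite N12 SD.
Qed.

Lemma counit_coproduct_E w z c :
  lift2 T2 (fun p q => t2 p (eps_id eps (e (t2 q c)))) (S w z) = e (t2 (nu w z) c).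
Proof.
(* [M] is [id (x) eps (x) id]. On the right-hand side [eps] meets the second leg of [S w s], which
   leaves [nu w s] by [epsS]. *)
pose M := lift3 T3 (fun x y z => eps y *: t2 x z).
have lin_M : islinear M by rewrite /M; lin.
have M23 p t : M (ext23 p t) = t2 p (eps_id eps t).
  have ? := ext23_bil T2 T3.
  tensor t; rewrite ext23E /M; liftE.
  by rewrite (islinearZ _ _ (proj2 (tens2_bilin T2) _)).
have M12 r t : M (ext12 t r) = t2 (id_eps eps t) r.
  have ? := ext12_bil T2 T3.
  tensor t; rewrite ext12E /M; liftE.
  by rewrite (islinearZ _ _ (proj1 (tens2_bilin T2) _)).
have := f_equal M (coproduct_E_elements w z c).
have -> : M (lift2 T2 (fun p q => ext23 p (e (t2 q c))) (S w z)) =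
    lift2 T2 (fun p q => t2 p (eps_id eps (e (t2 q c)))) (S w z).
  by move: (S w z) => t; tensor t; rewrite M23.
move=> ->; rewrite -(leg1E _ _ _ (proj2 bnu w)) e1; move: (e _) => t.
by rewrite /leg1; text t; liftE; rewrite M12 epsS.
Qed.

End CounitOfCoproductE.

(** The relations between two of [T1] to [T4] evaluate products such as
    [(c (x) 1) Delta(a) (1 (x) b)] in two ways. Without mention of [Delta], the list is visibly
    stable under the opposite algebra and the opposite coalgebra. *)
Record bialg_data (k : fieldType) (A : lmodType k) (T : tensor2 A) (mu : A -> A -> A)
    (T1 T2 T3 T4 : A -> A -> tt2 T) (EL ER : tt2 T -> tt2 T) (eps : A -> k) : Prop :=
  BialgData {
  bd_alg : nondegenerate_algebra mu;
  bd_T1 : isbilinear T1; bd_T2 : isbilinear T2;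
  bd_T3 : isbilinear T3; bd_T4 : isbilinear T4;
  bd_EL : islinear EL; bd_ER : islinear ER;
  bd_eps : isfunctional eps;
  bd_T12 : forall a b c, leg2 (mu^~ b) (T2 c a) = leg1 (mu c) (T1 a b);
  bd_T13 : forall a b c, leg2 (mu c) (T1 a b) = leg2 (mu^~ b) (T3 a c);
  bd_T34 : forall a b c, leg2 (mu b) (T4 c a) = leg1 (mu^~ c) (T3 a b);
  bd_T24 : forall a b c, leg1 (mu^~ b) (T2 c a) = leg1 (mu c) (T4 b a);
  bd_eps1 : forall a b, eps_id eps (T1 a b) = mu a b;
  bd_eps2 : forall a b, id_eps eps (T2 a b) = mu a b;
  bd_eps3 : forall a b, eps_id eps (T3 a b) = mu b a;
  bd_eps4 : forall a b, id_eps eps (T4 a b) = mu b a;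
  bd_ELT1 : forall a b, EL (T1 a b) = T1 a b;
  bd_ERT2 : forall a b, ER (T2 a b) = T2 a b;
  bd_ERT3 : forall a b, ER (T3 a b) = T3 a b;
  bd_ELT4 : forall a b, EL (T4 a b) = T4 a b;
  bd_E : forall a b x y, leg1 (mu a) (leg2 (mu b) (EL (tens2 T x y))) =
    leg1 (mu^~ x) (leg2 (mu^~ y) (ER (tens2 T a b)));
  bd_ER1 : forall a t, ER (leg1 (mu a) t) = leg1 (mu a) (ER t);
  bd_ER2 : forall a t, ER (leg2 (mu a) t) = leg2 (mu a) (ER t);
  bd_EL1 : forall a t, EL (leg1 (mu^~ a) t) = leg1 (mu^~ a) (EL t);
  bd_EL2 : forall a t, EL (leg2 (mu^~ a) t) = leg2 (mu^~ a) (EL t) }.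

Lemma nondegenerate_algebra_op (k : fieldType) (A : lmodType k) (mu : A -> A -> A) :
  nondegenerate_algebra mu -> nondegenerate_algebra (fun x y => mu y x).
Proof.
case=> [[b1 b2] assoc idem ndl ndr]; split=> // a.
apply: span_sub (idem a) => _ [b [c ->]].
by apply: span_mem; exists c, b.
Qed.

Lemma leg_comm (k : fieldType) (A : lmodType k) (T : tensor2 A) f g t :
  islinear f -> islinear g ->
  leg1 (T := T) f (leg2 (T := T) g t) = leg2 (T := T) g (leg1 (T := T) f t).
Proof. by move=> ? ?; tensor t. Qed.

(** Reversing products exchanges [Delta(a) (1 (x) b)] with [(1 (x) b) Delta(a)], hence [T1] with
    [T3], [T2] with [T4] and [EL] with [ER]. *)
Lemma bialg_data_op (k : fieldType) (A : lmodType k) (T : tensor2 A) (mu : A -> A -> A)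
    (T1 T2 T3 T4 : A -> A -> tt2 T) (EL ER : tt2 T -> tt2 T) (eps : A -> k) :
  bialg_data mu T1 T2 T3 T4 EL ER eps ->
  bialg_data (fun x y => mu y x) T3 T4 T1 T2 ER EL eps.
Proof.
move=> H; have HA := bd_alg H; have := H; case=> *; split=> //.
exact: nondegenerate_algebra_op.
Qed.

(** After the flip, the role of [Delta(a) (1 (x) b)] is taken by [Delta(a) (b (x) 1) = T4 b a]; so
    [T1] and [T4], likewise [T2] and [T3], change places with exchanged arguments. *)
Lemma bialg_data_cop (k : fieldType) (A : lmodType k) (T : tensor2 A) (mu : A -> A -> A)
    (T1 T2 T3 T4 : A -> A -> tt2 T) (EL ER : tt2 T -> tt2 T) (eps : A -> k) :
  bialg_data mu T1 T2 T3 T4 EL ER eps ->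
  bialg_data (T := swap2 T) mu (fun a b => T4 b a) (fun a b => T3 b a)
    (fun a b => T2 b a) (fun a b => T1 b a) EL ER eps.
Proof.
move=> H; have HA := bd_alg H; have := H.
case=> ? [? ?] [? ?] [? ?] [? ?] *; split=> //; try by split.
all: move=> *; rewrite /eps_id /id_eps /om_id /id_om ?leg1_swap ?leg2_swap ?lift2_swap; eauto.
have lmu a : islinear (mu a) by case: (alg_bil HA).
have rmu a : islinear (mu^~ a) by case: (alg_bil HA).
by rewrite -!leg_comm // (bd_E H).
Qed.

Section LegEvaluation.
Variables (k : fieldType) (A : lmodType k) (T : tensor2 A) (eps : A -> k).
Hypothesis lin_eps : isfunctional eps.

Lemma id_om_linear : islinear (id_om (T2 := T) eps).
Proof. by rewrite /id_om; lin. Qed.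

Lemma om_id_linear : islinear (om_id (T2 := T) eps).
Proof. by rewrite /om_id; lin. Qed.

Lemma id_omE a b : id_om eps (tens2 T a b) = eps b *: a.
Proof. by rewrite /id_om; liftE. Qed.

Lemma om_idE a b : om_id eps (tens2 T a b) = eps a *: b.
Proof. by rewrite /om_id; liftE. Qed.

Lemma id_om_leg1 f t : islinear f -> id_om eps (leg1 (T := T) f t) = f (id_om eps t).
Proof.
by move=> Hf; rewrite /id_om /leg1; text t; liftE; rewrite (islinearZ _ _ Hf).
Qed.

Lemma om_id_leg2 f t : islinear f -> om_id eps (leg2 (T := T) f t) = f (om_id eps t).
Proof.
by move=> Hf; rewrite /om_id /leg2; text t; liftE; rewrite (islinearZ _ _ Hf).
Qed.

Lemma id_om_leg2 f t : islinear f ->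
  id_om eps (leg2 (T := T) f t) = id_om (fun x => eps (f x)) t.
Proof. by move=> Hf; rewrite /id_om /leg2; text t; liftE. Qed.

End LegEvaluation.

Lemma om_id_om (k : fieldType) (A : lmodType k) (T : tensor2 A) (om phi : A -> k) t :
  isfunctional om -> isfunctional phi ->
  om (om_id phi t) = phi (id_om (T2 := T) om t).
Proof.
move=> lin_om lin_phi.
have lin_id_om := @id_om_linear _ _ T _ lin_om.
have lin_om_id := @om_id_linear _ _ T _ lin_phi.
apply: (@tens2_ext k A T k^o (fun t => om (om_id phi t)) (fun t => phi (id_om om t))).
- exact: (isfunctional_comp lin_om lin_om_id).
- exact: (isfunctional_comp lin_phi lin_id_om).
- move=> a b; rewrite om_idE // id_omE //.
  by rewrite [LHS](@islinearZ k A k^o om _ _ lin_om)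
    [RHS](@islinearZ k A k^o phi _ _ lin_phi) /GRing.scale /= mulrC.
Qed.

(** Carries the multiplier identity from [PibarL] to [PibarR]. If [T2 w z = sum p (x) q], the
    hypothesis on [ER], multiplied on the right by [x] and [d], expresses [w z] times [E] applied to
    the tensor of [x] and [d] as [sum p x (x) PibarL(q) d]; then [id (x) eps] is applied. *)
Lemma PibarR_multiplier (k : fieldType) (A : lmodType k) (T : tensor2 A) (mu : A -> A -> A)
    (T1 T2 T3 T4 : A -> A -> tt2 T) (EL ER : tt2 T -> tt2 T) (eps : A -> k) :
  bialg_data mu T1 T2 T3 T4 EL ER eps ->
  (forall w z c, lift2 T (fun p q => tens2 T p (eps_id eps (ER (tens2 T q c)))) (T2 w z) =
    ER (tens2 T (mu w z) c)) ->
  (forall a b c, mu (eps_id eps (ER (tens2 T a b))) c = mu b (eps_id eps (T2 a c))) ->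
  forall a b c, mu c (id_eps eps (EL (tens2 T b a))) = mu (id_eps eps (T1 c a)) b.
Proof.
move=> H F vi d x z; have HA := bd_alg H; have bm := alg_bil HA.
have [lin_EL lin_ER bT1 bT2] := And4 (bd_EL H) (bd_ER H) (bd_T1 H) (bd_T2 H).
have lin_eps := bd_eps H; have lin_ie := @id_om_linear _ _ T _ lin_eps.
have lin_ei : islinear (eps_id (T2 := T) eps) := @om_id_linear _ _ T _ lin_eps.
apply: (cancel_family (alg_injl HA)) => w.
have L2 : lift2 T (fun p q => tens2 T (mu p x) (eps_id eps (T2 q d))) (T2 w z) =
    leg1 (mu (mu w z)) (EL (tens2 T x d)).
  apply: (leg2_cancel (alg_injl HA)) => c; rewrite -leg_comm; [|lin|lin].
  rewrite (bd_E H) -F; move: (T2 w z) => t; rewrite /leg1 /leg2; text t; liftE.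
  by rewrite vi.
have := f_equal (id_eps eps) L2.
rewrite [RHS](id_om_leg1 lin_eps); [|lin]; rewrite (alg_assoc HA) => <-.
rewrite -(alg_assoc HA).
have -> : mu w (id_eps eps (T1 z d)) = id_eps eps (leg2 (mu^~ d) (T2 w z)).
  by rewrite (bd_T12 H) [RHS](id_om_leg1 lin_eps) //; lin.
move: (T2 w z) => t; rewrite /leg2; text t; liftE.
rewrite [LHS](id_omE _ lin_eps) [id_eps _ _](id_omE _ lin_eps).
(* [eps(PibarL(q) d) = eps(q d)], since both are [(eps (x) eps)(T2 q d)]. *)
by rewrite (om_id_om _ lin_eps lin_eps) [id_om _ _](bd_eps2 H) (islinearZ _ _ (proj1 bm x)).
Qed.

(** * Full comultiplications *)

Lemma id_om_in_span (k : fieldType) (A : lmodType k) (T : tensor2 A) I (f : I -> A -> A)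
    (om : A -> k) (t : tt2 T) :
  jointly_injective f -> isfunctional om ->
  Defs.span (fun x => exists i (om' : A -> k), isfunctional om' /\
    x = id_om om' (leg2 (f i) t)) (id_om om t).
Proof.
move=> Hf lin_om; apply: NNPP => nspan.
have [phi [lin_phi phi0 phi1]] := separating_functional (span_subspace _) nspan.
have t0 : om_id phi t = 0.
  apply: (proj2 Hf) => i; apply: separated => om' lin_om'.
  rewrite -(om_id_leg2 lin_phi); last exact: (proj1 Hf).
  by rewrite om_id_om // phi0 //; apply: span_mem; exists i, om'.
have := oner_neq0 k; rewrite -phi1 -(om_id_om t lin_om lin_phi) t0.
by rewrite (@islinear0 k A k^o om lin_om) eqxx.
Qed.

(** [EL] yields [PibarR(p) c] and [ER] yields [c PiR(p)], so the fields read
    [PibarR(z1) c (x) z2 w = E (c (x) z w)], [c PiR(z1) (x) w z2 = (c (x) w z) E], and the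
    multiplier identities of [PibarR] and [PiR]. *)
Record base_data (k : fieldType) (A : lmodType k) (T : tensor2 A) (mu : A -> A -> A)
    (T1 T2 T3 T4 : A -> A -> tt2 T) (EL ER : tt2 T -> tt2 T) (eps : A -> k) : Prop :=
  BaseData {
  base_bialg : bialg_data mu T1 T2 T3 T4 EL ER eps;
  base_EL : forall z w c,
    lift2 T (fun p q => tens2 T (id_eps eps (EL (tens2 T c p))) q) (T1 z w) =
    EL (tens2 T c (mu z w));
  base_ER : forall z w c,
    lift2 T (fun p q => tens2 T (id_eps eps (ER (tens2 T c p))) q) (T3 z w) =
    ER (tens2 T c (mu w z));
  base_PibarR : forall a b c,
    mu c (id_eps eps (EL (tens2 T b a))) = mu (id_eps eps (T1 c a)) b;
  base_PiR : forall a b c,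
    mu (id_eps eps (ER (tens2 T b a))) c = mu b (id_eps eps (T3 c a)) }.

Lemma base_data_op (k : fieldType) (A : lmodType k) (T : tensor2 A) (mu : A -> A -> A)
    (T1 T2 T3 T4 : A -> A -> tt2 T) (EL ER : tt2 T -> tt2 T) (eps : A -> k) :
  base_data mu T1 T2 T3 T4 EL ER eps ->
  base_data (fun x y => mu y x) T3 T4 T1 T2 ER EL eps.
Proof. by case=> /bialg_data_op *; split. Qed.

Definition legs_span (k : fieldType) (A : lmodType k) (T : tensor2 A)
    (S : A -> A -> tt2 T) : Prop :=
  spans_all (fun x => exists a b (om : A -> k), isfunctional om /\ x = id_om om (S a b)).

Definition counit_legs_span (k : fieldType) (A : lmodType k) (T : tensor2 A)
    (eps : A -> k) (S : A -> A -> tt2 T) : Prop :=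
  spans_all (fun x => exists a b, x = id_eps eps (S a b)).

Section FullHalf.
Variables (k : fieldType) (A : lmodType k) (T : tensor2 A) (mu : A -> A -> A).
Variables (T1 T2 T3 T4 : A -> A -> tt2 T) (EL ER : tt2 T -> tt2 T) (eps : A -> k).
Hypothesis H : base_data mu T1 T2 T3 T4 EL ER eps.
Local Notation t2 := (tens2 T).
Let B := base_bialg H.
Let HA := bd_alg B.
Let bm := alg_bil HA.
Let bT1 := bd_T1 B.
Let bT2 := bd_T2 B.
Let lin_EL := bd_EL B.
Let lin_ER := bd_ER B.
Let lin_eps := bd_eps B.
Let lin_ie : islinear (id_eps (T2 := T) eps) := id_om_linear lin_eps.

Let lmu a : islinear (mu a) := proj2 bm a.
Let rmu a : islinear (mu^~ a) := proj1 bm a.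
Let leg1_lin f : islinear f -> islinear (leg1 (T := T) f) := @leg1_linear _ _ T f.
Let leg2_lin f : islinear f -> islinear (leg2 (T := T) f) := @leg2_linear _ _ T f.

Lemma legs_span_regular : legs_span T1 -> legs_span T3.
Proof.
move=> H1 v; apply: (span_sub _ (H1 v)) => _ [a [b [om [lin_om ->]]]].
apply: (span_sub _ (id_om_in_span (T1 a b) (alg_injl HA) lin_om)).
move=> _ [c [om' [lin_om' ->]]]; rewrite (bd_T13 B) id_om_leg2 //.
by apply: span_mem; exists a, c, (fun x => om' (mu x b)); split=> //; lin.
Qed.

Lemma counit_legs_span_legs_span : counit_legs_span eps T1 -> legs_span T1.
Proof.
move=> H1 v; apply: (span_sub _ (H1 v)) => _ [a [b ->]].
by apply: span_mem; exists a, b, eps.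
Qed.

(** Slicing [base_EL] by [om] makes [(id (x) om)(E (1 (x) b c))] a value of [PibarR]; the multiplier
    identity brings in [p]. *)
Lemma PibarR_slice om p x b c : isfunctional om ->
  mu p (id_om om (EL (t2 x (mu b c)))) =
  mu (id_eps eps (T1 p (id_om om (T1 b c)))) x.
Proof.
move=> lin_om; rewrite -(base_EL H).
have lin_io := @id_om_linear _ _ T _ lin_om.
move: (T1 b c) => u; text u; liftE; rewrite !id_omE //.
rewrite (islinearZ _ _ (proj2 bm p)) (base_PibarR H) (islinearZ _ _ (proj2 bT1 p)).
by rewrite (islinearZ _ _ lin_ie) (islinearZ _ _ (proj1 bm x)).
Qed.

Lemma leg_T1_product om a b b' c : isfunctional om ->
  mu c (id_om om (T1 a (mu b b'))) =
  lift2 T (fun p q => id_eps eps (T1 p (id_om (fun y => om (mu q y)) (T1 b b'))))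
    (T2 c a).
Proof.
move=> lin_om; have lin_io := @id_om_linear _ _ T _ lin_om.
pose F q y := om (mu q y).
have lin_F q : isfunctional (F q) by rewrite /F; lin.
apply: (cancel_family (alg_injr HA)) => x.
rewrite -[mu c _](id_om_leg1 lin_om (f := mu c)) // -(bd_T12 B).
rewrite -[LHS](id_om_leg1 lin_om (f := mu^~ x)) // -(bd_ERT2 B).
have lin_Z : isbilinear (fun p q => id_eps eps (T1 p (id_om (F q) (T1 b b')))).
  by rewrite /F {1}/id_om; lin.
(* [T2 c a = (T2 c a) E] is used on the left-hand side only; [bd_E] then makes [E] act on the tensor
   of [x] and [b b']. *)
rewrite (bd_ERT2 B) -{1}(bd_ERT2 B); move: (T2 c a) => t.
text t; liftE; rewrite -(bd_E B) (id_om_leg1 lin_om) // (id_om_leg2 lin_om) //.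
by apply: PibarR_slice; apply: lin_F.
Qed.

Lemma span_idem_ind (S : A -> Prop) :
  subspace S -> (forall a b, S (mu a b)) -> forall a, S a.
Proof.
by move=> HS Sab a; apply: (span_min HS _ (alg_idem HA a)) => _ [b [c ->]].
Qed.

Lemma legs_span_counit_legs_span : legs_span T1 -> counit_legs_span eps T1.
Proof.
move=> H1; pose P x := exists a b, x = id_eps eps (T1 a b).
have sP := span_subspace P; rewrite -[counit_legs_span _ _]/(forall v, Defs.span P v).
apply: span_idem_ind => // c v.
apply: (span_min (S := fun v => Defs.span P (mu c v)) _ _ (H1 v)).
  exact: (subspace_preim (lmu c)).
move=> _ [a [b [om [lin_om ->]]]]; have lin_io := @id_om_linear _ _ T _ lin_om.
(* The slices of [E (1 (x) b b')] are the ones that come from [PibarR], so [b] is replaced by a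
   product. *)
move: b; apply: span_idem_ind => [|b b'].
  by apply: (subspace_preim (f := fun b => mu c (id_om om (T1 a b)))) => //; lin.
rewrite leg_T1_product //; move: (T2 c a); apply: tens2_ind => [|p q].
  apply: (subspace_preim (f := lift2 T _)) => //.
  by rewrite /id_om; lin.
rewrite lift2E; last by rewrite /id_om; lin.
by apply: span_mem; exists p; eexists.
Qed.

(** [base_ER] concerns [T3]: a factor [w] on the second leg trades [T1] for [T3] and is cancelled at
    the end. *)
Lemma PiR_slice x a b om : isfunctional om ->
  id_eps eps (ER (t2 x (id_om om (T1 a b)))) =
  id_om om (leg2 (mu^~ b) (ER (t2 x a))).
Proof.
move=> lin_om; have lin_io := @id_om_linear _ _ T _ lin_om.
have <- : lift2 T (fun p q => t2 (id_eps eps (ER (t2 x p))) q) (T1 a b) =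
    leg2 (mu^~ b) (ER (t2 x a)).
  apply: (leg2_cancel (alg_injl HA)) => w.
  transitivity (lift2 T (fun p q => t2 (id_eps eps (ER (t2 x p))) q)
      (leg2 (mu w) (T1 a b))).
    by move: (T1 a b) => t; text t; rewrite leg2E //; liftE; rewrite leg2E.
  rewrite (bd_T13 B).
  transitivity (leg2 (mu^~ b)
    (lift2 T (fun p q => t2 (id_eps eps (ER (t2 x p))) q) (T3 a w))).
    by move: (T3 a w) => t; text t; rewrite leg2E //; liftE; rewrite leg2E.
  rewrite (base_ER H) -(leg2E _ _ _ (lmu w)) (bd_ER2 B).
  by move: (ER _) => t; text t; rewrite !leg2E // (alg_assoc HA).
move: (T1 a b) => t; text t; liftE; rewrite !id_omE //.
by rewrite (islinearZ _ _ (proj2 (tens2_bilin T) x)) (islinearZ _ _ lin_ER)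
  (islinearZ _ _ lin_ie).
Qed.

Lemma legs_span_PiR_PibarR : legs_span T1 -> forall a, exists a',
  (forall b, id_eps eps (T3 b a) = id_eps eps (EL (t2 b a'))) /\
  (forall b, id_eps eps (ER (t2 b a)) = id_eps eps (T1 b a')).
Proof.
move=> H1 a.
(* Agreement of the right actions suffices: [c (PibarR(a') b) = (c PibarR(a')) b = (c PiR(a)) b = c
   (PiR(a) b)]. *)
suff [a' Ha'] : exists a', forall b, id_eps eps (ER (t2 b a)) = id_eps eps (T1 b a').
  exists a'; split=> // b; apply: (cancel_family (alg_injl HA)) => c.
  by rewrite (base_PibarR H) -Ha' (base_PiR H).
pose Q a := exists a', forall b, id_eps eps (ER (t2 b a)) = id_eps eps (T1 b a').
have sQ : subspace Q.
  split=> [|c x y [x' Hx] [y' Hy]].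
    exists 0 => b; rewrite (islinear0 (proj2 bT1 b)).
    by rewrite (islinear0 (proj2 (tens2_bilin T) b)) (islinear0 lin_ER).
  exists (c *: x' + y') => b.
  by rewrite (proj2 bT1) (proj2 (tens2_bilin T)) lin_ER !lin_ie Hx Hy.
apply: (span_min sQ _ (H1 a)) => _ {a} [a [b [om [lin_om ->]]]].
have lin_io := @id_om_linear _ _ T _ lin_om.
move: b; apply: span_idem_ind => [|b b'].
  by apply: (subspace_preim (f := fun b => id_om om (T1 a b))) => //; lin.
(* With this witness both multipliers are [(id (x) om)((1 (x) a) E (1 (x) b b'))]. *)
exists (id_om (fun y => om (mu a y)) (T1 b b')) => x.
apply: (cancel_family (alg_injr HA)) => y.
rewrite -PibarR_slice; last by lin.
rewrite PiR_slice // -(id_om_leg2 lin_om (f := mu a)) //.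
rewrite -[LHS](id_om_leg1 lin_om (f := mu^~ y)) // -(bd_E B).
by rewrite (id_om_leg1 lin_om).
Qed.

(** Since [T2 a b] is fixed by right multiplication by [E], [a b = (id (x) eps)(T2 a b)] is a sum of
    terms [p PiR(q)], and each [PiR(q)] is some [PibarR(q')]. *)
Lemma PiR_PibarR_counit_legs_span :
  (forall a, exists a', forall b, id_eps eps (ER (t2 b a)) = id_eps eps (T1 b a')) ->
  counit_legs_span eps T1.
Proof.
move=> H5; pose P x := exists a b, x = id_eps eps (T1 a b).
have sP := span_subspace P; rewrite -[counit_legs_span _ _]/(forall v, Defs.span P v).
apply: span_idem_ind => // a b; rewrite -(bd_eps2 B) -(bd_ERT2 B).
move: (T2 a b); apply: tens2_ind => [|p q].
  by apply: (subspace_preim (f := fun t => id_eps eps (ER t))) => //; lin.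
by have [q' ->] := H5 q; apply: span_mem; exists p, q'.
Qed.

End FullHalf.

Section Full.
Variables (k : fieldType) (A : lmodType k) (T : tensor2 A) (mu : A -> A -> A).
Variables (T1 T2 T3 T4 : A -> A -> tt2 T) (EL ER : tt2 T -> tt2 T) (eps : A -> k).
Hypothesis H : base_data mu T1 T2 T3 T4 EL ER eps.
Let Hop := base_data_op H.

(** The implications that start from [T3] are those for [T1] in the opposite algebra. *)
Lemma full_comultiplication :
  [<-> legs_span T1; legs_span T3; counit_legs_span eps T1; counit_legs_span eps T3;
    (forall a, exists a',
      (forall b, id_eps eps (T3 b a) = id_eps eps (EL (tens2 T b a'))) /\
      (forall b, id_eps eps (ER (tens2 T b a)) = id_eps eps (T1 b a'))) /\
    (forall a, exists a',
      (forall b, id_eps eps (T1 b a) = id_eps eps (ER (tens2 T b a'))) /\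
      (forall b, id_eps eps (EL (tens2 T b a)) = id_eps eps (T3 b a')))].
Proof.
tfae.
- exact: (legs_span_regular H).
- by move=> /(legs_span_regular Hop); apply: (legs_span_counit_legs_span H).
- move=> /(counit_legs_span_legs_span H) /(legs_span_regular H).
  exact: (legs_span_counit_legs_span Hop).
- move=> /(counit_legs_span_legs_span Hop) H3; split.
    exact: (legs_span_PiR_PibarR H (legs_span_regular Hop H3)).
  exact: (legs_span_PiR_PibarR Hop H3).
- case=> H5 _; apply: (counit_legs_span_legs_span H).
  apply: (PiR_PibarR_counit_legs_span H) => a.
  by have [a' [_ ?]] := H5 a; exists a'.
Qed.

End Full.

(** * Instantiation to regular weak multiplier bialgebras *)

Section MulLegs.
Variables (k : fieldType) (A : lmodType k) (T : tensor2 A) (mu : A -> A -> A).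
Hypothesis HA : nondegenerate_algebra mu.
Local Notation t2 := (tens2 T).
Local Notation mul2 := (mul2 (T2 := T) mu).
Let bm := alg_bil HA.
Let b2 := mul2_bil T HA.
Let lmu a : islinear (mu a) := proj2 bm a.
Let rmu a : islinear (mu^~ a) := proj1 bm a.
Let l1 f : islinear f -> islinear (leg1 (T := T) f) := @leg1_linear _ _ T f.
Let l2 f : islinear f -> islinear (leg2 (T := T) f) := @leg2_linear _ _ T f.

Ltac mul2_leg s t :=
  text s; text t; rewrite ?leg1E ?leg2E // !(mul2E T HA) ?leg1E ?leg2E // ?(alg_assoc HA).

Lemma mul2_leg1_mid a s t : mul2 s (leg1 (mu a) t) = mul2 (leg1 (mu^~ a) s) t.
Proof. by mul2_leg s t. Qed.

Lemma mul2_leg2_mid a s t : mul2 s (leg2 (mu a) t) = mul2 (leg2 (mu^~ a) s) t.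
Proof. by mul2_leg s t. Qed.

Lemma mul2_leg1r a s t : mul2 s (leg1 (mu^~ a) t) = leg1 (mu^~ a) (mul2 s t).
Proof. by mul2_leg s t. Qed.

Lemma mul2_leg2r a s t : mul2 s (leg2 (mu^~ a) t) = leg2 (mu^~ a) (mul2 s t).
Proof. by mul2_leg s t. Qed.

Lemma mul2_leg1l a s t : mul2 (leg1 (mu a) s) t = leg1 (mu a) (mul2 s t).
Proof. by mul2_leg s t. Qed.

Lemma mul2_leg2l a s t : mul2 (leg2 (mu a) s) t = leg2 (mu a) (mul2 s t).
Proof. by mul2_leg s t. Qed.

Lemma mul2_purel a b t : mul2 (t2 a b) t = leg1 (mu a) (leg2 (mu b) t).
Proof. by text t; rewrite (mul2E T HA) leg2E // leg1E. Qed.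

Lemma mul2_purer a b t : mul2 t (t2 a b) = leg1 (mu^~ a) (leg2 (mu^~ b) t).
Proof. by text t; rewrite (mul2E T HA) leg2E // leg1E. Qed.

End MulLegs.

Lemma elt_spec (k : fieldType) (B : lmodType k) (mulB : B -> B -> B) m :
  in_alg mulB m -> iota mulB (elt mulB m) = m.
Proof. exact: epsilon_spec. Qed.

(** * Passage to the opposite coalgebra *)

Section Swap.
Variables (k : fieldType) (A : lmodType k) (T2 : tensor2 A) (T3 : tensor3 A).
Variables (mu : A -> A -> A) (E : mult (tt2 T2)) (Delta : A -> mult (tt2 T2)).

Lemma mul2_swap : mul2 (T2 := swap2 T2) mu = mul2 (T2 := T2) mu.
Proof.
apply: boolp.funext => s; apply: boolp.funext => t; rewrite /mul2 lift2_swap.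
congr lift2; apply: boolp.funext => a; apply: boolp.funext => b.
by rewrite lift2_swap.
Qed.

Lemma mul3_swap : mul3 (T3 := swap3 T3) mu = mul3 (T3 := T3) mu.
Proof.
apply: boolp.funext => s; apply: boolp.funext => t; rewrite /mul3 lift3_swap.
congr lift3; apply: boolp.funext => a; apply: boolp.funext => b.
by apply: boolp.funext => c; rewrite lift3_swap.
Qed.

Lemma ext12_swap t c : ext12 (T2 := swap2 T2) (swap3 T3) t c = ext23 (T2 := T2) T3 c t.
Proof. by rewrite /ext12 lift2_swap. Qed.

Lemma ext23_swap a t : ext23 (T2 := swap2 T2) (swap3 T3) a t = ext12 (T2 := T2) T3 t a.
Proof. by rewrite /ext23 lift2_swap. Qed.

Ltac funext3 :=
  rewrite lift3_swap; refine (f_equal (@lift3 _ _ T3 (tt3 T3)) _);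
  apply: boolp.funext => ?; apply: boolp.funext => ?; apply: boolp.funext => ?;
  rewrite ?ext12_swap ?ext23_swap.

Lemma E_one_swap : E_one (T2 := swap2 T2) (swap3 T3) E = one_E T3 E.
Proof. by congr pair; funext3. Qed.

Lemma one_E_swap : one_E (T2 := swap2 T2) (swap3 T3) E = E_one T3 E.
Proof. by congr pair; funext3. Qed.

Lemma Delta_id_swap a b :
  Delta_id (T2 := swap2 T2) (swap3 T3) mu Delta a b = id_Delta T3 mu Delta b a.
Proof. by congr pair; funext3. Qed.

(** Lets the part of axiom (v) on [id (x) Delta] be used through the results on [Delta (x) id]. *)
Lemma is_mult_ext_swap e G :
  is_mult_ext (T2 := swap2 T2) mu (Delta_id (T2 := swap2 T2) (swap3 T3) mu Delta) e G ->
  is_mult_ext (T2 := T2) (T3 := T3) mu (id_Delta T3 mu Delta) e G.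
Proof.
rewrite /is_mult_ext mul2_swap mul3_swap => -[G1 G2 G3 G4 G5]; split=> // a b.
exact: (etrans (G4 b a) (Delta_id_swap b a)).
Qed.

Lemma comult_data_swap EL ER DL DR :
  comult_data (T2 := T2) mu EL ER DL DR ->
  comult_data (T2 := swap2 T2) mu EL ER DL DR.
Proof.
by case=> ? ? ? ? [? ?] [? ?] *; split; rewrite ?mul2_swap //; split.
Qed.

End Swap.

(** * The operator data of a regular weak multiplier bialgebra *)

Section Wmba.
Variables (k : fieldType) (A : lmodType k) (T2 : tensor2 A) (T3 : tensor3 A).
Variables (mu : A -> A -> A) (EL ER : tt2 T2 -> tt2 T2) (DL DR : A -> tt2 T2 -> tt2 T2).
Variable eps : A -> k.
Local Notation E := ((EL, ER) : mult (tt2 T2)).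
Local Notation Delta := (fun a => (DL a, DR a) : mult (tt2 T2)).
Hypothesis W : regular_wmba T3 mu E Delta eps.
Local Notation t2 := (tens2 T2).
Local Notation mul2 := (mul2 (T2 := T2) mu).
Local Notation S1 := (T1e mu Delta).
Local Notation S2 := (T2e mu Delta).
Local Notation S3 := (T3e mu Delta).
Local Notation S4 := (T4e mu Delta).

Lemma wmba_algebra : nondegenerate_algebra mu.
Proof.
case: W => -[bm assoc] [surj [[ndl ndr] _]]; split=> // a.
have [t <-] := surj a; move: t; apply: tens2_ind => [|b c].
  by apply: subspace_preim (span_subspace _); rewrite /mu2; lin.
by rewrite /mu2; liftE; apply: span_mem; exists b, c.
Qed.
Let HA := wmba_algebra.

Lemma wmba_comult : comult_data mu EL ER DL DR.
Proof.
case: W => _ [_ [_ [[[lEL lER ME] EE] [[MD Dlin DM] [_ [_ [_ [_ [[spL spR] _]]]]]]]]].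
have bDL : isbilinear DL.
  split=> [y c a b|a]; last by case: (MD a).
  exact: (f_equal (fun m => m.1 y) (Dlin c a b)).
have bDR : isbilinear DR.
  split=> [y c a b|a]; last by case: (MD a).
  exact: (f_equal (fun m => m.2 y) (Dlin c a b)).
have EEL s : EL (EL s) = EL s := f_equal (fun m => m.1 s) EE.
have EER s : ER (ER s) = ER s := f_equal (fun m => m.2 s) EE.
split=> //.
- by move=> a; case: (MD a).
- by move=> a b s; apply: (f_equal (fun m => m.1 s) (DM a b)).
- by move=> a b s; apply: (f_equal (fun m => m.2 s) (DM a b)).
(* [E Delta(a) = Delta(a)]: by axiom (iv) the values of [Delta(a)] lie in the span of those of [E],
   which [E] fixes. *)
- move=> a s; text s; rename a0 into x.
  have /spL : Defs.span (fun t => exists a b b', t = DL a (t2 b b')) (DL a (t2 x b)).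
    by apply: span_mem; exists a, x, b.
  apply: (span_min (S := fun t => EL t = t)) => [|_ [y [z ->]]]; last exact: EEL.
  exact: (islinear_subspace lEL (@islinear_id _ _)).
- move=> a s; text s; rename a0 into x.
  have /spR : Defs.span (fun t => exists a b b', t = DR a (t2 b b')) (DR a (t2 x b)).
    by apply: span_mem; exists a, x, b.
  apply: (span_min (S := fun t => ER t = t)) => [|_ [y [z ->]]]; last exact: EER.
  exact: (islinear_subspace lER (@islinear_id _ _)).
- apply: tens2_ind => [|x y]; first exact: subspace_preim (span_subspace _).
  have /spL : Defs.span (fun t => exists b b', t = EL (t2 b b')) (EL (t2 x y)).
    by apply: span_mem; exists x, y.
  by apply: span_sub => _ [a [b [b' ->]]]; apply: span_mem; exists a, (t2 b b').
- apply: tens2_ind => [|x y]; first exact: subspace_preim (span_subspace _).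
  have /spR : Defs.span (fun t => exists b b', t = ER (t2 b b')) (ER (t2 x y)).
    by apply: span_mem; exists x, y.
  by apply: span_sub => _ [a [b [b' ->]]]; apply: span_mem; exists a, (t2 b b').
Qed.
Let C := wmba_comult.

Let in_algs a b : [/\ in_alg mul2 (mmul (Delta a) (one_t T2 mu b)),
                      in_alg mul2 (mmul (t_one T2 mu a) (Delta b)),
                      in_alg mul2 (mmul (one_t T2 mu b) (Delta a)) &
                      in_alg mul2 (mmul (Delta b) (t_one T2 mu a))].
Proof. by case: W => _ [_ [_ [_ [_ [_ [H _]]]]]]; apply: H. Qed.

(** By axiom (i) and regularity the chosen element represents its multiplier, so products with it
    are explicit; later identities are compared through them. *)
Lemma T1e_spec a b s : mul2 (S1 a b) s = DL a (leg2 (mu b) s) /\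
  mul2 s (S1 a b) = leg2 (mu^~ b) (DR a s).
Proof.
have [/elt_spec H _ _ _] := in_algs a b.
by split; [have := f_equal (fun m => m.1 s) H | have := f_equal (fun m => m.2 s) H].
Qed.

Lemma T2e_spec a b s : mul2 (S2 a b) s = leg1 (mu a) (DL b s) /\
  mul2 s (S2 a b) = DR b (leg1 (mu^~ a) s).
Proof.
have [_ /elt_spec H _ _] := in_algs a b.
by split; [have := f_equal (fun m => m.1 s) H | have := f_equal (fun m => m.2 s) H].
Qed.

Lemma T3e_spec a b s : mul2 (S3 a b) s = leg2 (mu b) (DL a s) /\
  mul2 s (S3 a b) = DR a (leg2 (mu^~ b) s).
Proof.
have [_ _ /elt_spec H _] := in_algs a b.
by split; [have := f_equal (fun m => m.1 s) H | have := f_equal (fun m => m.2 s) H].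
Qed.

Lemma T4e_spec a b s : mul2 (S4 a b) s = DL b (leg1 (mu a) s) /\
  mul2 s (S4 a b) = leg1 (mu^~ a) (DR b s).
Proof.
have [_ _ _ /elt_spec H] := in_algs a b.
by split; [have := f_equal (fun m => m.1 s) H | have := f_equal (fun m => m.2 s) H].
Qed.

Let bm := alg_bil HA.
Let b2 := mul2_bil T2 HA.
Let bDL := cm_DL C.
Let bDR := cm_DR C.
Let lmu a : islinear (mu a) := proj2 bm a.
Let rmu a : islinear (mu^~ a) := proj1 bm a.
Let l1 f : islinear f -> islinear (leg1 (T := T2) f) := @leg1_linear _ _ T2 f.
Let l2 f : islinear f -> islinear (leg2 (T := T2) f) := @leg2_linear _ _ T2 f.

(** [T1e] comes from a choice, so bilinearity is read off from its products with [s], which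
    determine it. *)
Lemma T1e_bilinear : isbilinear S1.
Proof.
split=> [b|a] c x y; apply: (mul2_cancell HA) => s; rewrite (proj2 b2) !(T1e_spec _ _ _).2.
  by have : islinear (fun a => leg2 (mu^~ b) (DR a s)) by lin.
by have : islinear (fun b => leg2 (mu^~ b) (DR a s)) by rewrite /leg2; lin.
Qed.

Lemma T2e_bilinear : isbilinear S2.
Proof.
split=> [b|a] c x y; apply: (mul2_cancell HA) => s; rewrite (proj2 b2) !(T2e_spec _ _ _).2.
  by have : islinear (fun a => DR b (leg1 (mu^~ a) s)) by rewrite /leg1; lin.
by have : islinear (fun b => DR b (leg1 (mu^~ a) s)) by lin.
Qed.

Lemma T3e_bilinear : isbilinear S3.
Proof.
split=> [b|a] c x y; apply: (mul2_cancell HA) => s; rewrite (proj2 b2) !(T3e_spec _ _ _).2.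
  by have : islinear (fun a => DR a (leg2 (mu^~ b) s)) by lin.
by have : islinear (fun b => DR a (leg2 (mu^~ b) s)) by rewrite /leg2; lin.
Qed.

Lemma T4e_bilinear : isbilinear S4.
Proof.
split=> [b|a] c x y; apply: (mul2_cancell HA) => s; rewrite (proj2 b2) !(T4e_spec _ _ _).2.
  by have : islinear (fun a => leg1 (mu^~ a) (DR b s)) by rewrite /leg1; lin.
by have : islinear (fun b => leg1 (mu^~ a) (DR b s)) by lin.
Qed.

Lemma EL_mul s t : mul2 (EL s) t = EL (mul2 s t).
Proof.
by apply: (mul2_cancell HA) => u; rewrite (cm_E C) -!(mul2A HA) (cm_E C).
Qed.

Lemma ER_mul s t : mul2 s (ER t) = ER (mul2 s t).
Proof.
by apply: (mul2_cancelr HA) => u; rewrite -(cm_E C) !(mul2A HA) (cm_E C).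
Qed.

Let mul2_legs := (@mul2_leg1_mid _ _ T2 _ HA, @mul2_leg2_mid _ _ T2 _ HA,
  @mul2_leg1r _ _ T2 _ HA, @mul2_leg2r _ _ T2 _ HA).

Lemma wmba_bialg : bialg_data mu S1 S2 S3 S4 EL ER eps.
Proof.
have [_ [_ [_ [_ [_ [lin_eps [_ [_ [epsT _]]]]]]]]] := W.
have sp1 a b s := (T1e_spec a b s).2; have sp2 a b s := (T2e_spec a b s).2.
have sp3 a b s := (T3e_spec a b s).2; have sp4 a b s := (T4e_spec a b s).2.
have T13 a b c : leg2 (mu c) (S1 a b) = leg2 (mu^~ b) (S3 a c).
  by apply: (mul2_cancell HA) => s; rewrite !mul2_legs sp1 sp3.
have T24 a b c : leg1 (mu^~ b) (S2 c a) = leg1 (mu c) (S4 b a).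
  by apply: (mul2_cancell HA) => s; rewrite !mul2_legs sp2 sp4.
split.
- exact: HA.
- exact: T1e_bilinear.
- exact: T2e_bilinear.
- exact: T3e_bilinear.
- exact: T4e_bilinear.
- exact: (cm_EL C).
- exact: (cm_ER C).
- exact: lin_eps.
- by move=> a b c; apply: (mul2_cancell HA) => s; rewrite !mul2_legs sp1 sp2.
- exact: T13.
- by move=> a b c; apply: (mul2_cancell HA) => s; rewrite !mul2_legs sp3 sp4.
- exact: T24.
- by move=> a b; case: (epsT a b).
- by move=> a b; case: (epsT a b).
(* The counit rules of [T3] and [T4] come from those of [T1] and [T2]: here
   [(1 (x) b) Delta(a) (1 (x) w)] is evaluated both ways and [w] is cancelled. *)
- move=> a b; apply: (cancel_family (alg_injr HA)) => w.
  rewrite -[LHS](om_id_leg2 lin_eps (f := mu^~ w)) // -T13 (om_id_leg2 lin_eps) //.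
  by rewrite [om_id _ _](proj1 (epsT _ _)) (alg_assoc HA).
- move=> a b; apply: (cancel_family (alg_injl HA)) => w.
  rewrite -[LHS](id_om_leg1 lin_eps (f := mu w)) // -T24 (id_om_leg1 lin_eps) //.
  by rewrite [id_om _ _](proj2 (epsT _ _)) (alg_assoc HA).
- move=> a b; apply: (mul2_cancelr HA) => s.
  by rewrite EL_mul (T1e_spec _ _ _).1 (cm_ELDL C).
- by move=> a b; apply: (mul2_cancell HA) => s; rewrite ER_mul sp2 (cm_ERDR C).
- by move=> a b; apply: (mul2_cancell HA) => s; rewrite ER_mul sp3 (cm_ERDR C).
- move=> a b; apply: (mul2_cancelr HA) => s.
  by rewrite EL_mul (T4e_spec _ _ _).1 (cm_ELDL C).
- by move=> a b x y; rewrite -(mul2_purel HA) -(mul2_purer HA) (cm_E C).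
- move=> a t; apply: (mul2_cancelr HA) => s.
  by rewrite (mul2_leg1l HA) -!(cm_E C) (mul2_leg1l HA).
- move=> a t; apply: (mul2_cancelr HA) => s.
  by rewrite (mul2_leg2l HA) -!(cm_E C) (mul2_leg2l HA).
- by move=> a t; apply: (mul2_cancell HA) => s; rewrite !mul2_legs !(cm_E C) !mul2_legs.
- by move=> a t; apply: (mul2_cancell HA) => s; rewrite !mul2_legs !(cm_E C) !mul2_legs.
Qed.
Let B := wmba_bialg.

(** First half of axiom (vi): both sides equal [(eps (x) id)(Delta(c) (a (x) b))]. The second half
    gives [PibarL_multiplier] in the same way. *)
Lemma PiL_multiplier a b c :
  mu c (eps_id eps (EL (t2 a b))) = mu (eps_id eps (S4 a c)) b.
Proof.
have lin_eps := bd_eps B.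
have [_ [_ [_ [_ [_ [_ [_ [_ [_ [_ [_ [vi _]]]]]]]]]]]] := W.
rewrite -[LHS](om_id_leg2 lin_eps (f := mu c)) // [LHS]vi /=.
rewrite -[RHS](om_id_leg2 lin_eps (f := mu^~ b)) //; congr om_id.
apply: (mul2_cancell HA) => s; rewrite (cm_D C) (mul2_purer HA) mul2_legs.
by rewrite (T4e_spec _ _ _).2 leg_comm.
Qed.

Lemma PibarL_multiplier a b c :
  mu (eps_id eps (ER (t2 a b))) c = mu b (eps_id eps (S2 a c)).
Proof.
have lin_eps := bd_eps B.
have [_ [_ [_ [_ [_ [_ [_ [_ [_ [_ [_ [_ vi]]]]]]]]]]]] := W.
rewrite -[LHS](om_id_leg2 lin_eps (f := mu^~ c)) // [LHS]vi /=.
rewrite -[RHS](om_id_leg2 lin_eps (f := mu b)) //; congr om_id.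
apply: (mul2_cancelr HA) => s; rewrite -(cm_D C) (mul2_purel HA) (mul2_leg2l HA).
by rewrite (T2e_spec _ _ _).1 leg_comm.
Qed.

Let Cs := comult_data_swap C.
Let Bs := bialg_data_cop B.

Lemma E3_first G : is_mult_ext mu (Delta_id T3 mu Delta) (E_one T3 E) G ->
  G E = mmul (E_one T3 E) (one_E T3 E) /\ G E = mmul (one_E T3 E) (E_one T3 E).
Proof. by have [_ [_ [_ [_ [_ [_ [_ [_ [_ [_ [[_ _ H] _]]]]]]]]]]] := W; apply: H. Qed.

Lemma E3_second G :
  is_mult_ext (T2 := swap2 T2) mu (Delta_id (T2 := swap2 T2) (swap3 T3) mu Delta)
    (E_one (T2 := swap2 T2) (swap3 T3) E) G ->
  G E = mmul (E_one (T2 := swap2 T2) (swap3 T3) E) (one_E (T2 := swap2 T2) (swap3 T3) E) /\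
  G E = mmul (one_E (T2 := swap2 T2) (swap3 T3) E) (E_one (T2 := swap2 T2) (swap3 T3) E).
Proof.
rewrite E_one_swap one_E_swap => /is_mult_ext_swap HG.
have [_ [_ [_ [_ [_ [_ [_ [_ [_ [_ [[_ H _] _]]]]]]]]]]] := W.
by case: (H G HG).
Qed.

(** Reads [w z1 (x) c PibarL(z2) = (w z (x) c) E]. The three lemmas that follow are its versions for
    the opposite algebra, the opposite coalgebra and both at once; they concern [PiL], [PiR] and
    [PibarR]. *)
Lemma counit_ER w z c :
  lift2 T2 (fun p q => t2 p (eps_id eps (ER (t2 q c)))) (S2 w z) = ER (t2 (mu w z) c).
Proof.
apply: (counit_coproduct_E (T3 := T3) (D := DR) bm (alg_injl HA) (bd_ER B) bDR (bd_T2 B)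
  (bd_eps B)) => [h v {}w {}z|||{}z {}c s u|].
- by rewrite -(mul2_purel HA) (T2e_spec _ _ _).2 leg1E.
- exact: (bd_ER1 B).
- exact: (bd_ER2 B).
- exact: (coproduct_E_right C E3_first).
- exact: (bd_eps2 B).
Qed.

Lemma counit_EL w z c :
  lift2 T2 (fun p q => t2 p (eps_id eps (EL (t2 q c)))) (S4 w z) = EL (t2 (mu z w) c).
Proof.
have [br bl] := bm.
apply: (counit_coproduct_E (T3 := T3) (nu := fun x y => mu y x) (D := DL) _ (alg_injr HA)
  (bd_EL B) bDL (bd_T4 B) (bd_eps B)) => [|h v {}w {}z|||{}z {}c s u|].
- by split.
- by rewrite -(mul2_purer HA) (T4e_spec _ _ _).1 leg1E.
- exact: (bd_EL1 B).
- exact: (bd_EL2 B).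
- exact: (coproduct_E_left C E3_first).
- exact: (bd_eps4 B).
Qed.

Lemma counit_ER_swap w z c :
  lift2 T2 (fun p q => t2 (id_eps eps (ER (t2 c p))) q) (S3 z w) = ER (t2 c (mu w z)).
Proof.
have := @counit_coproduct_E k A (swap2 T2) (swap3 T3) mu ER DR (fun a b => S3 b a) eps
  bm (alg_injl HA) (bd_ER B) bDR (bd_T2 Bs) (bd_eps B) _ (bd_ER1 Bs) (bd_ER2 Bs)
  (coproduct_E_right Cs E3_second) (bd_eps2 Bs) w z c.
rewrite /eps_id !lift2_swap; apply=> h v {}w {}z.
rewrite leg1_swap leg2_swap -leg_comm // -(mul2_purel HA) (T3e_spec _ _ _).2 leg2E //.
Qed.

Lemma counit_EL_swap w z c :
  lift2 T2 (fun p q => t2 (id_eps eps (EL (t2 c p))) q) (S1 z w) = EL (t2 c (mu z w)).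
Proof.
have [br bl] := bm.
have := @counit_coproduct_E k A (swap2 T2) (swap3 T3) (fun x y => mu y x) EL DL
  (fun a b => S1 b a) eps (conj bl br) (alg_injr HA) (bd_EL B) bDL (bd_T4 Bs) (bd_eps B) _
  (bd_EL1 Bs) (bd_EL2 Bs) (coproduct_E_left Cs E3_second) (bd_eps4 Bs) w z c.
rewrite /eps_id !lift2_swap; apply=> h v {}w {}z.
by rewrite leg1_swap leg2_swap -leg_comm // -(mul2_purer HA) (T1e_spec _ _ _).1 leg2E.
Qed.

(** The multiplier identities of [PibarR] and [PiR] are transported from [PibarL] and [PiL], for
    which axiom (vi) supplies them. *)
Lemma wmba_base : base_data mu S1 S2 S3 S4 EL ER eps.
Proof.
split=> // [z w c|z w c||a b c].
- exact: counit_EL_swap.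
- exact: counit_ER_swap.
- exact: (PibarR_multiplier B counit_ER PibarL_multiplier).
- apply: (PibarR_multiplier (bialg_data_op B) counit_EL) => {}a {}b {}c.
  exact: PiL_multiplier.
Qed.

(** In the opposite coalgebra [PiL] and [PibarL] take the places of [PibarR] and [PiR], so axiom
    (vi) applies directly. *)
Lemma wmba_base_cop : base_data (T := swap2 T2) mu (fun a b => S4 b a)
  (fun a b => S3 b a) (fun a b => S2 b a) (fun a b => S1 b a) EL ER eps.
Proof.
split=> // [z w c|z w c|a b c|a b c]; rewrite /id_eps !lift2_swap.
- exact: counit_EL.
- exact: counit_ER.
- exact: PiL_multiplier.
- exact: PibarL_multiplier.
Qed.

End Wmba.

(** * Translation into the stated conditions *)

Section SwapSpans.
Variables (k : fieldType) (A : lmodType k) (T : tensor2 A) (S : A -> A -> tt2 T).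

Lemma legs_span_swap : legs_span (T := swap2 T) (fun a b => S b a) <->
  spans_all (fun x => exists a b (om : A -> k), isfunctional om /\ x = om_id om (S a b)).
Proof.
by split=> H v; apply: span_sub (H v) => _ [a [b [om [? ->]]]]; apply: span_mem;
  exists b, a, om; split=> //; rewrite /id_om lift2_swap.
Qed.

Lemma counit_legs_span_swap eps :
  counit_legs_span (T := swap2 T) eps (fun a b => S b a) <->
  spans_all (fun x => exists a b, x = eps_id eps (S a b)).
Proof.
by split=> H v; apply: span_sub (H v) => _ [a [b ->]]; apply: span_mem;
  exists b, a; rewrite /id_eps lift2_swap.
Qed.

End SwapSpans.

Lemma mult_eqP (B : Type) (f g f' g' : B -> B) :
  ((f, g) = (f', g') :> mult B) <-> (forall b, f b = f' b) /\ (forall b, g b = g' b).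
Proof.
split=> [[-> ->] //|[ff' gg']].
by congr pair; apply: boolp.funext.
Qed.

Lemma same_multipliers (A B : Type) (m m' : A -> mult B) (P P' : A -> A -> Prop) :
  (forall a a', m a = m' a' <-> P a a') -> (forall a a', m' a = m a' <-> P' a a') ->
  ((forall a, exists a', m a = m' a') /\ (forall a, exists a', m' a = m a')) <->
  ((forall a, exists a', P a a') /\ (forall a, exists a', P' a a')).
Proof.
move=> mP mP'; split=> -[H1 H2]; split=> a.
- by have [a' /mP ?] := H1 a; exists a'.
- by have [a' /mP' ?] := H2 a; exists a'.
- by have [a' /mP ?] := H1 a; exists a'.
- by have [a' /mP' ?] := H2 a; exists a'.
Qed.

Lemma tfae5_iff (P1 P2 P3 P4 P5 Q1 Q2 Q3 Q4 Q5 : Prop) :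
  (P1 <-> Q1) -> (P2 <-> Q2) -> (P3 <-> Q3) -> (P4 <-> Q4) -> (P5 <-> Q5) ->
  [<-> P1; P2; P3; P4; P5] -> [<-> Q1; Q2; Q3; Q4; Q5].
Proof. by do 5!move=> /boolp.propext <-. Qed.

Theorem theorem3p13 (k : fieldType) (A : lmodType k) (T2 : tensor2 A)
    (T3 : tensor3 A) (mu : A -> A -> A) (E : mult (tt2 T2))
    (Delta : A -> mult (tt2 T2)) (eps : A -> k) :
  regular_wmba T3 mu E Delta eps ->
  [<-> spans_all (fun x : A => exists a b (om : A -> k),
                     isfunctional om /\ x = id_om om (T1e mu Delta a b));
       spans_all (fun x : A => exists a b (om : A -> k),
                     isfunctional om /\ x = id_om om (T3e mu Delta a b));
       spans_all (fun x : A => exists a b, x = id_eps eps (T1e mu Delta a b));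
       spans_all (fun x : A => exists a b, x = id_eps eps (T3e mu Delta a b));
       (forall a, exists a', PiR mu E Delta eps a = PibarR mu E Delta eps a') /\
       (forall a, exists a', PibarR mu E Delta eps a = PiR mu E Delta eps a')]
  /\
  [<-> spans_all (fun x : A => exists a b (om : A -> k),
                     isfunctional om /\ x = om_id om (T2e mu Delta a b));
       spans_all (fun x : A => exists a b (om : A -> k),
                     isfunctional om /\ x = om_id om (T4e mu Delta a b));
       spans_all (fun x : A => exists a b, x = eps_id eps (T2e mu Delta a b));
       spans_all (fun x : A => exists a b, x = eps_id eps (T4e mu Delta a b));
       (forall a, exists a', PiL mu E Delta eps a = PibarL mu E Delta eps a') /\
       (forall a, exists a', PibarL mu E Delta eps a = PiL mu E Delta eps a')].
Proof.
case: E => EL ER.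
have [DL [DR ->]] : exists DL DR, Delta = fun a => (DL a, DR a).
  exists (fun a => (Delta a).1), (fun a => (Delta a).2).
  by apply: boolp.funext => a; apply: surjective_pairing.
move=> W; split.
  apply: tfae5_iff (full_comultiplication (wmba_base W)) => //.
  apply: iff_sym; apply: same_multipliers => a a'; rewrite /PiR /PibarR mult_eqP.
    exact: iff_refl.
  exact: and_comm.
(* The second list is the first one for the opposite coalgebra; the opposite algebra is taken as
   well so that [T2] comes before [T4]. *)
apply: tfae5_iff (full_comultiplication (base_data_op (wmba_base_cop W))).
- exact: legs_span_swap.
- exact: legs_span_swap.
- exact: counit_legs_span_swap.
- exact: counit_legs_span_swap.
apply: iff_sym; apply: same_multipliers => a a';
  rewrite /PiL /PibarL mult_eqP /id_eps !lift2_swap.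
  exact: and_comm.
exact: iff_refl.
Qed.
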